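(* Let $\alpha>-1$, $1<q<p<\infty$. Let $\omega$ be a weight and $\mu$ a positive Borel measure on $\mathcal H$. Assume that $\Phi\in B_p$ and that $\omega\in\mathbb{B}_{\infty,\alpha}$. Then there exists a constant $C_1>0$ such that for any $f\in L^p(\mathcal H,\omega\,dV_\alpha)$, $$\left(\int_{\mathcal H}\left(\mathcal{M}_{\Phi,\omega,\alpha}f(z)\right)^q d\mu(z)\right)^{1/q}\le C_1\left(\int_{\mathcal H}|f(z)|^p\omega(z)\,dV_\alpha(z)\right)^{1/p}$$ if and only if the function $$K_\mu(z):=\sup_{I\subset\mathbb R,\ I\text{ interval},\ z\in Q_I}\frac{\mu(Q_I)}{|Q_I|_{\omega,\alpha}}$$ belongs to $L^s(\mathcal H,\omega\,dV_\alpha)$, where $s=\frac{p}{p-q}$.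
   Context: $\mathcal H=\{z=x+iy\in\mathbb C: x\in\mathbb R,\ y>0\}$ is the upper-half plane and $dV_\alpha(x+iy)=y^\alpha\,dx\,dy$. A weight is a nonnegative locally integrable function on $\mathcal H$. $L^r(\mathcal H,\omega\,dV_\alpha)$ is the set of functions $f$ on $\mathcal H$ with $\int_{\mathcal H}|f|^r\omega\,dV_\alpha<\infty$. Intervals $I\subset\mathbb R$ are bounded and of positive length $|I|$; the Carleson square of $I$ is $Q_I=\{x+iy: x\in I,\ 0<y<|I|\}$. For $E\subset\mathcal H$ measurable, $|E|_{\omega,\alpha}=\int_E\omega\,dV_\alpha$ and $|E|_\alpha=\int_E dV_\alpha$. A Young function is a function $\Phi:[0,\infty)\to[0,\infty)$ that is continuous, convex and increasing, with $\Phi(0)=0$ and $\Phi(t)\to\infty$ as $t\to\infty$; throughout, $\Phi(1)=1$. For $1<p<\infty$, $\Phi\in B_p$ means that $\Phi$ is a Young function satisfying the $\Delta_2$ condition (there is $K>1$ with $\Phi(2t)\le K\Phi(t)$ for all $t\ge0$) and there is $c>0$ with $\int_c^\infty\frac{\Phi(t)}{t^p}\frac{dt}{t}<\infty$. Luxembourg norm: $\|f\|_{Q_I,\Phi,\omega,\alpha}=\inf\{\lambda>0:\frac{1}{|Q_I|_{\omega,\alpha}}\int_{Q_I}\Phi\left(\frac{|f(z)|}{\lambda}\right)\omega(z)\,dV_\alpha(z)\le1\}$. Maximal function: $\mathcal{M}_{\Phi,\omega,\alpha}f(z)=\sup\|f\|_{Q_I,\Phi,\omega,\alpha}$, the supremum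 being over all intervals $I\subset\mathbb R$ with $z\in Q_I$. Békollè-Bonami classes: for $1<r<\infty$ with conjugate exponent $r'$, $\omega\in\mathcal{B}_{r,\alpha}$ if $$[\omega]_{\mathcal{B}_{r,\alpha}}=\sup_{I}\left(\frac{1}{|Q_I|_\alpha}\int_{Q_I}\omega\,dV_\alpha\right)\left(\frac{1}{|Q_I|_\alpha}\int_{Q_I}\omega^{1-r'}dV_\alpha\right)^{r-1}<\infty,$$ the supremum over all intervals $I\subset\mathbb R$; and $\mathbb{B}_{\infty,\alpha}=\bigcup_{r>1}\mathcal{B}_{r,\alpha}$. *)

(* Defs.v *)
From HB Require Import structures.
From mathcomp Require Import all_boot all_order all_algebra.
From mathcomp Require Import all_classical all_reals all_analysis.
From mathcomp Require Import measurable_realfun.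
From mathcomp Require Import complex.

Set Implicit Arguments.
Unset Strict Implicit.
Unset Printing Implicit Defensive.

Import Order.TTheory GRing.Theory Num.Theory.
Import numFieldNormedType.Exports.

Local Open Scope classical_set_scope.
Local Open Scope ring_scope.
Local Open Scope ereal_scope.

Section BekolleBonami.
Context {R : realType}.
Implicit Types (alpha p r : R) (omega : R * R -> R) (Phi : R -> R).
Implicit Types (I : set R) (z : R * R) (f : R * R -> R[i]).
Implicit Types (mu : {measure set (R * R) -> \bar R}).

(* The point x + iy is represented by the pair (x, y); the measurable structure
   of R * R is the product Borel sigma-algebra.  Functions and measures on the
   half-plane are given on R * R and only ever used inside [upper_half]. *)
Definition upper_half : set (R * R) := [set z | (0 < z.2)%R].

Definition int_dV alpha (E : set (R * R)) (g : R * R -> \bar R) : \bar R :=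
  \int[lebesgue_measure \x lebesgue_measure]_(z in E)
    (g z * (z.2 `^ alpha)%:E).

Definition volume alpha (E : set (R * R)) : \bar R := int_dV alpha E (cst 1).

Definition wvolume omega alpha (E : set (R * R)) : \bar R :=
  int_dV alpha E (EFin \o omega).

(* Local integrability does not depend on [alpha]: the density y `^ alpha is
   bounded above and below on compact subsets of the open half-plane. *)
Definition weight omega : Prop :=
  [/\ measurable_fun upper_half omega,
      (forall z, upper_half z -> (0 <= omega z)%R) &
      forall K : set (R * R), K `<=` upper_half -> compact K ->
        \int[lebesgue_measure \x lebesgue_measure]_(z in K) (omega z)%:E < +oo].

Definition bounded_itv I : Prop :=
  [/\ is_interval I, has_lbound I, has_ubound I & 0 < lebesgue_measure I].

Definition carleson I : set (R * R) :=
  [set z | [/\ I z.1, (0 < z.2)%R & (z.2)%:E < lebesgue_measure I]].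

(* Membership in L^r(omega dV_alpha) for [0, +oo]-valued functions. *)
Definition Lp_weighted r omega alpha (g : R * R -> \bar R) : Prop :=
  measurable_fun upper_half g /\
  int_dV alpha upper_half (fun z => g z `^ r * (omega z)%:E) < +oo.

Definition cmod f z : R := Normc.normc (f z).

Definition cLp_weighted r omega alpha f : Prop :=
  [/\ measurable_fun upper_half (fun z => complex.Re (f z)),
      measurable_fun upper_half (fun z => complex.Im (f z)) &
      Lp_weighted r omega alpha (EFin \o cmod f)].

Definition young Phi : Prop :=
  [/\ (forall t, (0 <= t)%R -> (0 <= Phi t)%R),
      {within `[0%R, +oo[, continuous Phi},
      convex_function (`[0%R, +oo[ : set R^o) (Phi : R^o -> R^o),
      {in `[0%R, +oo[ &, nondecreasing_fun Phi} &
      [/\ Phi 0%R = 0%R, Phi t @[t --> +oo%R] --> +oo%R & Phi 1%R = 1%R]].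

Definition Delta2 Phi : Prop :=
  exists2 K : R, (1 < K)%R &
    forall t, (0 <= t)%R -> (Phi (2 * t) <= K * Phi t)%R.

Definition class_B p Phi : Prop :=
  [/\ young Phi, Delta2 Phi &
      exists2 c : R, (0 < c)%R &
        \int[lebesgue_measure]_(t in `[c, +oo[)
          (Phi t / t `^ p / t)%:E < +oo].

(* The infimum of the empty set is +oo. *)
Definition luxembourg Phi omega alpha f I : \bar R :=
  ereal_inf [set l%:E | l in [set l : R | (0 < l)%R /\
    int_dV alpha (carleson I)
      (fun z => (Phi (cmod f z / l) * omega z)%:E)
    / wvolume omega alpha (carleson I) <= 1]].

Definition maximal Phi omega alpha f z : \bar R :=
  ereal_sup [set luxembourg Phi omega alpha f I | I in
    [set I | bounded_itv I /\ carleson I z]].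

Definition conjugate_exponent r : R := (r / (r - 1))%R.

(* omega^(1 - r') is written (omega^(r' - 1))^-1 with the inverse taken in the
   extended reals, so that it is +oo where omega vanishes; the real power
   function would give 0 there. *)
Definition BB_constant r omega alpha : \bar R :=
  ereal_sup [set
    (wvolume omega alpha (carleson I) / volume alpha (carleson I)) *
    (int_dV alpha (carleson I)
       (fun z => ((omega z `^ (conjugate_exponent r - 1))%:E)^-1)
     / volume alpha (carleson I)) `^ (r - 1)
    | I in bounded_itv].

Definition BB_class r omega alpha : Prop := BB_constant r omega alpha < +oo.

Definition BB_infty omega alpha : Prop :=
  exists2 r : R, (1 < r)%R & BB_class r omega alpha.

Definition K_fun mu omega alpha z : \bar R :=
  ereal_sup [set mu (carleson I) / wvolume omega alpha (carleson I) | I in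
    [set I | bounded_itv I /\ carleson I z]].

End BekolleBonami.

(* Main.v *)
Require Import Defs.
From HB Require Import structures.
From mathcomp Require Import all_boot all_order all_algebra.
From mathcomp Require Import all_classical all_reals all_analysis.
From mathcomp Require Import measurable_realfun.
From mathcomp Require Import complex.
From mathcomp Require Import ring lra.

Set Implicit Arguments.
Unset Strict Implicit.
Unset Printing Implicit Defensive.

Import Order.TTheory GRing.Theory Num.Theory.
Import numFieldNormedType.Exports.

Local Open Scope classical_set_scope.
Local Open Scope ring_scope.
Local Open Scope ereal_scope.

(* Write w for the measure omega dV_alpha.  Membership in some Bekolle-Bonami
   class makes w doubling on Carleson squares, so Vitali's covering lemma for
   intervals gives: if m1(Q_{5I}) <= a m2(Q_I) for all I in a family, then
   m1 <= a m2 on the union of the squares Q_I.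

   Sufficiency.  As mu(Q_{5I}) <= K_mu(z) w(Q_{5I}) for z in Q_I, the covering
   lemma yields mu(M f > t) <= C int_{M f > t} K_mu dw for every t, hence
   int (M f)^q dmu <= C int (M f)^q K_mu dw; conclude by Young's inequality and
   the boundedness of M on L^p(w), which follows from the same covering lemma
   and the convergence of sum_j 2^(-jp) Phi(2^j).

   Necessity.  Test the inequality on f = K^(1/(p-q)), where K is a bounded
   truncation of K_mu: M f >= K^(1/(p-q)) everywhere, so
   int K^(s-1) dmu <= C (int K^s dw)^(q/p), while the covering lemma gives
   t w(K > t) <= C mu(K > t), hence int K^s dw <= C int K^(s-1) dmu.
   The truncation makes int K^s dw finite, so it can be absorbed. *)

(** * Intervals and Carleson squares *)

Section intervals.
Context {R : realType}.
Implicit Types (I J : set R) (V : set (set R)).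

(** Three obstacles shape the proof. First, [mu] is an arbitrary measure, not assumed sigma-finite,
    so integrals are not compared through Fubini and the layer-cake formula. They are compared
    through sums over the levels t0 * 2^n, where sum and integral commute for every measure. Second,
    [maximal] and [K_fun] are suprema over an uncountable family of intervals. Both have the form
    sup of c I over the squares Q_I containing z, so their superlevel sets are unions of Carleson
    squares. Such unions are measurable, and a single weak-type lemma serves all the estimates, each
    with its own pair of measures. Third, the convention 0 * +oo = 0 lets a weight belong to the
    class although its dual integral is infinite, and then division by w(Q_I) loses its meaning. A
    dichotomy isolates this case: either omega dV_alpha is the null measure and both sides of the
    equivalence hold, or every Carleson square has finite positive weighted volume. *)

Definition len I : R := (sup I - inf I)%R.

Lemma bounded_itv_neq0 I : bounded_itv I -> I !=set0.
Proof.
move=> [_ _ _ I0]; apply/set0P/eqP => I_eq0.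
by move: I0; rewrite I_eq0 measure0 ltxx.
Qed.

Lemma bounded_itv_sub I : bounded_itv I -> I `<=` `[inf I, sup I]%classic.
Proof.
move=> [_ lI uI _] x Ix; rewrite /= in_itv/=; apply/andP; split.
  exact: ge_inf.
exact: ub_le_sup.
Qed.

Lemma bounded_itv_sup I : bounded_itv I -> `]inf I, sup I[%classic `<=` I.
Proof.
move=> bI; have I0 := bounded_itv_neq0 bI.
case: (bI) => iI lI uI _ x; rewrite /= in_itv/= => /andP[ix xs].
have [a Ia ax] := inf_lt I0 ix.
have [b Ib xb] := sup_gt I0 xs.
by apply: (iI a b) => //; rewrite (ltW ax) (ltW xb).
Qed.

Lemma bounded_itv_measurable I : bounded_itv I -> measurable I.
Proof. by move=> [iI _ _ _]; exact: is_interval_measurable. Qed.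

Lemma lebesgue_measure_bounded_itv I : bounded_itv I ->
  lebesgue_measure I = (len I)%:E.
Proof.
move=> bI; have mI := bounded_itv_measurable bI.
have Ilt : (inf I < sup I)%R.
  rewrite ltNge; apply/negP => sI; case: (bI) => _ _ _.
  rewrite ltNge => /negP; apply.
  apply: (@le_trans _ _ (lebesgue_measure `[inf I, sup I]%classic)).
    by apply: le_measure; rewrite ?inE//; exact: bounded_itv_sub.
  by rewrite lebesgue_measure_itv/= lte_fin ltNge sI.
apply/eqP; rewrite eq_le; apply/andP; split.
  apply: (@le_trans _ _ (lebesgue_measure `[inf I, sup I]%classic)).
    by apply: le_measure; rewrite ?inE//; exact: bounded_itv_sub.
  by rewrite lebesgue_measure_itv/= lte_fin Ilt.
apply: (@le_trans _ _ (lebesgue_measure `]inf I, sup I[%classic)).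
  by rewrite lebesgue_measure_itv/= lte_fin Ilt.
by apply: le_measure; rewrite ?inE//; exact: bounded_itv_sup.
Qed.

Lemma len_gt0 I : bounded_itv I -> (0 < len I)%R.
Proof.
by move=> bI; rewrite -lte_fin -lebesgue_measure_bounded_itv//; case: bI.
Qed.

Lemma le_len I J : bounded_itv I -> bounded_itv J -> I `<=` J ->
  (len I <= len J)%R.
Proof.
move=> bI bJ IJ; rewrite -lee_fin -!lebesgue_measure_bounded_itv//.
by apply: le_measure => //; rewrite inE; exact: bounded_itv_measurable.
Qed.

Lemma bounded_itvcc (a b : R) : (a < b)%R -> bounded_itv `[a, b]%classic.
Proof.
move=> ab; split.
- exact: interval_is_interval.
- by exists a => x; rewrite /= in_itv/= => /andP[].
- by exists b => x; rewrite /= in_itv/= => /andP[].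
- by rewrite lebesgue_measure_itv/= lte_fin ab -EFinD lte_fin subr_gt0.
Qed.

Lemma len_itvcc (a b : R) : (a < b)%R -> len `[a, b]%classic = (b - a)%R.
Proof.
move=> ab; apply: EFin_inj.
rewrite -lebesgue_measure_bounded_itv; last exact: bounded_itvcc.
by rewrite lebesgue_measure_itv/= lte_fin ab.
Qed.

Lemma carlesonP I (z : R * R) : bounded_itv I ->
  carleson I z <-> [/\ I z.1, (0 < z.2)%R & (z.2 < len I)%R].
Proof.
by move=> bI; rewrite /carleson/= lebesgue_measure_bounded_itv// lte_fin.
Qed.

Lemma carlesonE I : bounded_itv I ->
  carleson I = I `*` `]0%R, len I[%classic.
Proof.
move=> bI; apply/seteqP; split => z; rewrite carlesonP//=.
  by move=> [Iz z0 zI]; rewrite in_itv/= z0.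
by rewrite in_itv/= => -[Iz /andP[]].
Qed.

Lemma measurable_carleson I : bounded_itv I -> measurable (carleson I).
Proof.
move=> bI; rewrite carlesonE//; apply: measurableX => //.
exact: bounded_itv_measurable.
Qed.

Lemma carleson_sub I J : bounded_itv I -> bounded_itv J -> I `<=` J ->
  carleson I `<=` carleson J.
Proof.
move=> bI bJ IJ z; rewrite !carlesonP// => -[Iz z0 zI]; split => //.
  exact: IJ.
by rewrite (lt_le_trans zI)// le_len.
Qed.

Lemma carleson_upper_half I : carleson I `<=` upper_half.
Proof. by move=> z []. Qed.

Lemma measurable_upper_half : measurable (@upper_half R).
Proof.
rewrite (_ : upper_half = setT `*` `]0%R, +oo[%classic).
  exact: measurableX.
by apply/seteqP; split => z; rewrite /upper_half/= in_itv/= andbT// => -[].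
Qed.

(** The successor keeps the length positive already at n = 0. *)
Definition big_itv (n : nat) : set R := `[(- n.+1%:R)%R, (n.+1%:R)%R]%classic.

Lemma bounded_big_itv n : bounded_itv (big_itv n).
Proof. by apply: bounded_itvcc; rewrite gtrN. Qed.

Lemma sub_big_itv n m : (n <= m)%N -> big_itv n `<=` big_itv m.
Proof.
move=> nm x; rewrite /big_itv/= !in_itv/= => /andP[nx xn].
have ? : (n.+1%:R <= m.+1%:R :> R)%R by rewrite ler_nat.
by apply/andP; split; lra.
Qed.

Lemma bounded_itv_big I : bounded_itv I -> exists n, I `<=` big_itv n.
Proof.
move=> bI; exists (Num.truncn (`|inf I| + `|sup I|)%R).
move=> x /(bounded_itv_sub bI)/=; rewrite /big_itv/= !in_itv/= => /andP[ix xs].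
set s := (`|inf I| + `|sup I|)%R.
have s0 : (0 <= s)%R by rewrite addr_ge0.
have := truncnS_gt s; move: (Num.truncn s) => n sn.
have := ler_norm (sup I); have := ler_norm (- inf I); rewrite normrN.
have := normr_ge0 (sup I); have := normr_ge0 (inf I).
by move: sn; rewrite /s => *; apply/andP; split; lra.
Qed.

Lemma carleson_big (z : R * R) : upper_half z -> exists n, carleson (big_itv n) z.
Proof.
move=> z0; set s := (`|z.1| + z.2)%R; exists (Num.truncn s).
have := truncnS_gt s; move: (Num.truncn s) => n sn.
apply/carlesonP; first exact: bounded_big_itv.
rewrite /big_itv len_itvcc ?gtrN//= in_itv/=.
move: z0 sn; rewrite /upper_half /s/= => z0 sn.
have := ler_norm z.1; have := ler_norm (- z.1); rewrite normrN.
by have := normr_ge0 z.1; move=> *; split => //; [apply/andP; split|]; lra.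
Qed.

(* No interval of length larger than [a] fits in a cell [[k a, (k + 1) a[], so
   the union meets each cell in an initial and a final segment. *)
Lemma measurable_bigcup_long_itv V (a : R) : (0 < a)%R ->
  (forall I, V I -> bounded_itv I /\ (a < len I)%R) ->
  measurable (\bigcup_(I in V) I).
Proof.
move=> a0 Va.
pose lo (k : int) : R := (k%:~R * a)%R.
pose cell k : set R := `[lo k, (lo k + a)%R[%classic.
pose L k := [set x | cell k x /\
  exists I, [/\ V I, I x & exists2 y, I y & (y < lo k)%R]].
pose U k := [set x | cell k x /\
  exists I, [/\ V I, I x & exists2 y, I y & (lo k + a <= y)%R]].
have -> : \bigcup_(I in V) I = \bigcup_(k : int) (L k `|` U k).
  apply/seteqP; split => x; last first.
    by move=> [k _ [|] [_ [I [VI Ix _]]]]; exists I.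
  move=> [I VI Ix]; pose k := Num.floor (x / a); exists k => //.
  have cx : cell k x.
    rewrite /cell /lo/= in_itv/= -ler_pdivlMr// ge_floor/=.
    rewrite -{2}(mul1r a) -mulrDl -ltr_pdivrMr//.
    have := floorD1_gt (x / a); rewrite -/k intrD => h.
    exact: h.
  have [bI aI] := Va _ VI.
  have [[y [Iy ylo]]|nolo] := pselect (exists y, I y /\ (y < lo k)%R).
    by left; split => //; exists I; split => //; exists y.
  have [[y [Iy yup]]|noup] := pselect (exists y, I y /\ (lo k + a <= y)%R).
    by right; split => //; exists I; split => //; exists y.
  exfalso; have : (len I <= a)%R.
    have -> : a = len `[lo k, (lo k + a)%R]%classic.
      by rewrite len_itvcc; [ring|rewrite ltrDl].
    apply: le_len => //; first by apply: bounded_itvcc; rewrite ltrDl.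
    move=> y Iy; rewrite /= in_itv/=; apply/andP; split; rewrite leNgt.
      by apply/negP => ylo; apply: nolo; exists y.
    by apply/negP => /ltW yup; apply: noup; exists y.
  by rewrite leNgt aI.
apply: countable_bigcupT_measurable => // k; apply: measurableU.
- apply: is_interval_measurable => x y [] cx _ [] cy [I [VI Iy [w Iw wk]]] z xzy.
  move: cx cy; rewrite /cell/= !in_itv/= => /andP[x1 x2] /andP[y1 y2].
  case/andP: xzy => xz zy; split.
    by rewrite /cell/= in_itv/= (le_trans x1 xz)/= (le_lt_trans zy y2).
  exists I; split => //; last by exists w.
  have [[iI _ _ _] _] := Va _ VI; apply: (iI w y) => //.
  by rewrite zy (le_trans (ltW wk))// (le_trans x1).
- apply: is_interval_measurable => x y [] cx [I [VI Ix [w Iw wk]]] [] cy _ z xzy.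
  move: cx cy; rewrite /cell/= !in_itv/= => /andP[x1 x2] /andP[y1 y2].
  case/andP: xzy => xz zy; split.
    by rewrite /cell/= in_itv/= (le_trans x1 xz)/= (le_lt_trans zy y2).
  exists I; split => //; last by exists w.
  have [[iI _ _ _] _] := Va _ VI; apply: (iI x w) => //.
  by rewrite xz/= (le_trans zy)// (le_trans (ltW y2)).
Qed.

(** A point at height y lies in Q_I when I contains its abscissa and is longer than y. A rational q
    between y and [len I] turns the uncountable union into a countable union of rectangles, whose
    bases are unions of intervals longer than q. *)
Lemma measurable_bigcup_carleson V : V `<=` bounded_itv ->
  measurable (\bigcup_(I in V) carleson I).
Proof.
move=> Vb; pose W (a : R) := [set I | V I /\ (a < len I)%R].
have -> : \bigcup_(I in V) carleson I =
    \bigcup_(q : rat) if (0 < q)%R then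
      (\bigcup_(I in W (ratr q)) I) `*` `]0%R, ratr q]%classic else set0.
  apply/seteqP; split => z.
    move=> [I VI /(carlesonP _ (Vb _ VI))[Iz z0 zI]].
    have [q] := rat_in_itvoo zI; rewrite in_itv/= => /andP[zq qI].
    exists q => //; have q0 : (0 < q)%R by rewrite -(ltr0q R) (lt_trans z0).
    rewrite q0/= in_itv/= z0 (ltW zq); split => //.
    by exists I.
  move=> [q _]; case: ifPn => // q0 [/= [I [VI qI] Iz]].
  rewrite in_itv/= => /andP[z0 zq]; exists I => //.
  apply/carlesonP; first exact: Vb.
  by split => //; exact: le_lt_trans qI.
apply: countable_bigcupT_measurable => // q; case: ifPn => // q0.
apply: measurableX => //.
apply: (@measurable_bigcup_long_itv _ (ratr q)); first by rewrite ltr0q.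
by move=> I [VI qI]; split => //; exact: Vb.
Qed.

End intervals.

(** * Vitali covering by Carleson squares *)

Section covering.
Context {R : realType}.
Implicit Types (I J : set R) (V : set (set R)).

Definition midpoint I : R := ((inf I + sup I) / 2)%R.

(** Closed, so that it contains the closure of the dilated ball produced by Vitali's lemma; 5 is the
    dilation factor of that lemma. *)
Definition star I : set R :=
  `[(midpoint I - 5 / 2 * len I)%R, (midpoint I + 5 / 2 * len I)%R]%classic.

Let star_lt I : bounded_itv I ->
  (midpoint I - 5 / 2 * len I < midpoint I + 5 / 2 * len I)%R.
Proof. by move=> /len_gt0; lra. Qed.

Lemma bounded_star I : bounded_itv I -> bounded_itv (star I).
Proof. by move=> bI; apply: bounded_itvcc; exact: star_lt. Qed.

Lemma len_star I : bounded_itv I -> len (star I) = (5 * len I)%R.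
Proof. by move=> bI; rewrite /star len_itvcc; [lra|exact: star_lt]. Qed.

Lemma sub_star I : bounded_itv I -> I `<=` star I.
Proof.
move=> bI x /(bounded_itv_sub bI)/=; have := len_gt0 bI.
rewrite /star /midpoint /len /= !in_itv/= => l0 /andP[ix xs].
by apply/andP; split; lra.
Qed.

Lemma vitali_carleson V (L : R) : V `<=` bounded_itv ->
  (forall I, V I -> (len I <= L)%R) ->
  exists D, [/\ countable D, D `<=` V, trivIset D carleson &
    forall I, V I -> exists2 J, D J & carleson I `<=` carleson (star J)].
Proof.
move=> Vb VL.
(* The covering lemma wants a ball at every index, so sets of nonpositive length receive the dummy
   radius 1. *)
pose rad (I : set R) : R := if (0 < len I)%R then (len I / 2)%R else 1%R.
have rad_gt0 I : (0 < rad I)%R.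
  by rewrite /rad; case: ifPn => // l0; rewrite divr_gt0.
pose B (I : set R) : set R := ball (midpoint I) (rad I).
have cB I : cpoint (B I) = midpoint I by rewrite /B cpoint_ball.
have rB I : (radius (B I))%:num = rad I by rewrite /B radius_ball_num// ltW.
have ballB I : is_ball (B I).
  by apply/eqP; rewrite cB rB.
have sub_closure I : bounded_itv I -> I `<=` closure (B I).
  move=> bI x /(bounded_itv_sub bI)/=; rewrite in_itv/= => /andP[ix xs].
  rewrite /B closure_ballE closed_ballE// /closed_ball_/= /rad len_gt0//.
  by rewrite ler_norml /midpoint /len; apply/andP; split; lra.
have [D [cD DV tD HD]] : {D : set (set R) | [/\ countable D, D `<=` V,
    trivIset D (closure \o B) &
    forall i, V i -> exists j, [/\ D j, closure (B i) `&` closure (B j) !=set0,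
      ((radius (B i))%:num / 2 <= (radius (B j))%:num)%R &
      closure (B i) `<=` closure (scale_ball 5%:R (B j))]]}.
  apply: (@vitali_lemma_infinite R (set R : eqType) B V (L / 2)) => //.
    by move=> I; rewrite rB.
  move=> I VI; rewrite rB /rad len_gt0; last exact: Vb.
  by rewrite ler_pM2r// VL.
exists D; split => //.
  (* Each interval lies in its closed ball, so disjoint closed balls have disjoint Carleson squares
     above them. *)
  move=> I J DI DJ [z [[Iz _ _] [Jz _ _]]]; apply: tD => //.
  by exists z.1; split; apply: sub_closure => //; exact: Vb (DV _ _).
move=> I VI; have [J [DJ _ _ IJ]] := HD _ VI; exists J => //.
have bI := Vb _ VI; have bJ := Vb _ (DV _ DJ).
apply: carleson_sub => //; first exact: bounded_star.
move=> x /(sub_closure _ bI)/IJ; rewrite /scale_ball ballB cB rB.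
rewrite closure_ballE closed_ballE; last by rewrite mulr_gt0.
rewrite /closed_ball_/= /rad len_gt0// ler_norml /star/= in_itv/=.
by move=> /andP[ix xs]; apply/andP; split; lra.
Qed.

Lemma covering_bounded (m1 m2 : {measure set (R * R) -> \bar R}) V (L a : R) :
  V `<=` bounded_itv -> (forall I, V I -> (len I <= L)%R) -> (0 <= a)%R ->
  (forall I, V I -> m1 (carleson (star I)) <= a%:E * m2 (carleson I)) ->
  m1 (\bigcup_(I in V) carleson I) <= a%:E * m2 (\bigcup_(I in V) carleson I).
Proof.
move=> Vb VL a0 m12.
have [D [cD DV tD HD]] := vitali_carleson Vb VL.
have [f finj] := countable_injP _ cD.
(* The injection [f] enumerates the countable [D], finite or not: each fibre is empty or a single
   interval, and the empty ones contribute 0. *)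
pose Dn n := [set J | D J /\ f J = n].
pose F n := \bigcup_(J in Dn n) carleson (star J).
pose G n := \bigcup_(J in Dn n) carleson J.
have Dn_case n : Dn n = set0 \/ exists2 J, D J & Dn n = [set J].
  have [[J [DJ fJ]]|no] := pselect (exists J, Dn n J); last first.
    by left; apply/seteqP; split => // J DJ; apply: no; exists J.
  right; exists J => //; apply/seteqP; split => [K [DK fK]|K ->] //=.
  by apply: finj; rewrite ?inE// fJ.
have mG n : measurable (G n).
  by apply: measurable_bigcup_carleson => J [DJ _]; exact: Vb (DV _ _).
have mF n : measurable (F n).
  rewrite /F; have [->|[J DJ ->]] := Dn_case n; first by rewrite bigcup_set0.
  by rewrite bigcup_set1; apply: measurable_carleson; apply: bounded_star; exact: Vb (DV _ _).
have FG n : m1 (F n) <= a%:E * m2 (G n).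
  rewrite /F /G; have [->|[J DJ ->]] := Dn_case n.
    by rewrite !bigcup_set0 !measure0 mule0.
  by rewrite !bigcup_set1; exact: m12 (DV _ _).
have mV := measurable_bigcup_carleson Vb.
apply: (@le_trans _ _ (\sum_(n <oo) m1 (F n))).
  apply: measure_sigma_subadditive => // z [I VI Iz].
  have [J DJ IJ] := HD _ VI.
  by exists (f J) => //; exists J => //; exact: IJ.
apply: (@le_trans _ _ (\sum_(n <oo) a%:E * m2 (G n))).
  by apply: lee_nneseries => // n _; exact: FG.
rewrite nneseriesZl//; apply: lee_wpmul2l; first by rewrite lee_fin.
rewrite -measure_semi_bigcup//; last 2 first.
- move=> i j _ _ [z [[I [DI fI] Iz] [J [DJ fJ] Jz]]].
  by rewrite -fI -fJ; congr f; apply: tD => //; exists z.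
- exact: bigcup_measurable.
apply: le_measure; rewrite ?inE//; first exact: bigcup_measurable.
by move=> z [n _ [J [DJ _] Jz]]; exists J => //; exact: DV.
Qed.

(** Vitali's lemma needs bounded lengths. The subfamilies with [len I <= n%:R] increase to [V], and
    [m1] is continuous from below. *)
Lemma covering (m1 m2 : {measure set (R * R) -> \bar R}) V (a : R) :
  V `<=` bounded_itv -> (0 <= a)%R ->
  (forall I, V I -> m1 (carleson (star I)) <= a%:E * m2 (carleson I)) ->
  m1 (\bigcup_(I in V) carleson I) <= a%:E * m2 (\bigcup_(I in V) carleson I).
Proof.
move=> Vb a0 m12.
pose W (n : nat) := [set I | V I /\ (len I <= n%:R)%R].
pose F n := \bigcup_(I in W n) carleson I.
have Wb n : W n `<=` bounded_itv by move=> I [/Vb].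
have mF n : measurable (F n) by exact: measurable_bigcup_carleson.
have VF : \bigcup_(I in V) carleson I = \bigcup_n F n.
  apply/seteqP; split => z; last by move=> [n _ [I [VI _] Iz]]; exists I.
  move=> [I VI Iz]; exists (Num.truncn (len I)).+1 => //; exists I => //.
  by split => //; exact/ltW/truncnS_gt.
have mV := measurable_bigcup_carleson Vb.
have : m1 (F n) @[n --> \oo] --> m1 (\bigcup_n F n).
  apply: nondecreasing_cvg_mu => //; first by rewrite -VF.
  move=> n m nm; apply/subsetPset => z [I [VI In] Iz]; exists I => //.
  by split => //; rewrite (le_trans In)// ler_nat.
rewrite {1}VF => /cvg_lim <-//; apply: lime_le.
  apply: ereal_nondecreasing_is_cvgn => n m nm; apply: le_measure; rewrite ?inE//.
  move=> z [I [VI In] Iz]; exists I => //.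
  by split => //; rewrite (le_trans In)// ler_nat.
apply: nearW => n; apply: (@le_trans _ _ (a%:E * m2 (F n))).
  apply: (@covering_bounded m1 m2 _ n%:R) => //.
  - by move=> I [].
  - by move=> I [/m12].
apply: lee_wpmul2l; first by rewrite lee_fin.
by apply: le_measure; rewrite ?inE// => z [I [VI _] Iz]; exists I.
Qed.

End covering.

(** * Integrals through dyadic level sets *)

Section dyadic_levels.
Context {R : realType}.
Implicit Types (q : R) (x : \bar R).

Definition level (t0 : R) (n : nat) : R := (t0 * 2 ^+ n)%R.

(** Summed over [n], a discrete substitute for x^q: a geometric series over the levels below [x].
    The base level [t0] cuts off the small values and will tend to 0. *)
Definition level_term t0 q x n : \bar R :=
  if (level t0 n)%:E < x then (level t0 n `^ q)%:E else 0.

Lemma level_gt0 t0 n : (0 < t0)%R -> (0 < level t0 n)%R.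
Proof. by move=> t0_gt0; rewrite mulr_gt0// exprn_gt0. Qed.

Lemma levelS t0 n : level t0 n.+1 = (2 * level t0 n)%R.
Proof. by rewrite /level exprS; ring. Qed.

Lemma le_level t0 m n : (0 < t0)%R -> (m <= n)%N -> (level t0 m <= level t0 n)%R.
Proof.
by move=> t0_gt0 mn; rewrite ler_pM2l// ler_eXn2l// ltr1n.
Qed.

Lemma level_powR t0 q n : (0 < t0)%R ->
  (level t0 n `^ q = t0 `^ q * (2 `^ q) ^+ n)%R.
Proof.
move=> t0_gt0; rewrite /level powRM ?exprn_ge0//; last exact: ltW.
by congr (_ * _)%R; rewrite -powR_mulrn// powRAC powR_mulrn// powR_ge0.
Qed.

Lemma level_term_ge0 t0 q x n : 0 <= level_term t0 q x n.
Proof. by rewrite /level_term; case: ifPn => // _; rewrite lee_fin powR_ge0. Qed.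

Lemma level_unbounded t0 (y : R) : (0 < t0)%R -> exists n, (y < level t0 n)%R.
Proof.
move=> t0_gt0; exists (Num.truncn (y / t0)).+1.
rewrite /level mulrC -ltr_pdivrMr//.
apply: (lt_le_trans (truncnS_gt _)); rewrite -natrX ler_nat.
exact/ltnW/ltn_expl.
Qed.

Lemma level_cover t0 (y : R) : (0 < t0)%R -> (t0 < y)%R ->
  exists n, (level t0 n < y <= level t0 n.+1)%R.
Proof.
move=> t0_gt0 t0y.
have ex : exists n, (y <= level t0 n)%R.
  by have [n /ltW] := level_unbounded y t0_gt0; exists n.
case: (ex_minnP ex) => -[|n] yn nmin.
  by move: yn; rewrite /level expr0 mulr1 leNgt t0y.
exists n; rewrite yn andbT ltNge; apply/negP => /nmin.
by rewrite ltnn.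
Qed.

Lemma nneseries_ge_term (u : nat -> \bar R) n : (forall n, 0 <= u n) ->
  u n <= \sum_(i <oo) u i.
Proof.
move=> u0; apply: (@le_trans _ _ (\sum_(0 <= i < n.+1) u i)).
  by rewrite big_nat_recr//= leeDr// sume_ge0.
exact: nneseries_lim_ge.
Qed.

(** The largest level below [x] is at least x / 2, so its term alone, times 2^q, dominates x^q. When
    [x] is +oo every term is present and they are unbounded. *)
Lemma le_level_series t0 q x : (0 < t0)%R -> (0 < q)%R -> t0%:E < x ->
  x `^ q <= (2 `^ q)%:E * \sum_(n <oo) level_term t0 q x n.
Proof.
move=> t0_gt0 q_gt0; case: x => [y||]//.
  rewrite lte_fin => t0y; have [n /andP[ny yn]] := level_cover t0_gt0 t0y.
  apply: (@le_trans _ _ ((2 `^ q)%:E * level_term t0 q y%:E n)).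
    rewrite /level_term lte_fin ny poweR_EFin -EFinM lee_fin -powRM//.
      apply: ge0_ler_powR; first exact: ltW.
      - by rewrite nnegrE (le_trans (ltW t0_gt0))// ltW.
      - by rewrite nnegrE mulr_ge0// ltW// level_gt0.
      - by rewrite -levelS.
    by rewrite ltW// level_gt0.
  apply: lee_wpmul2l; first by rewrite lee_fin powR_ge0.
  by apply: nneseries_ge_term => k; exact: level_term_ge0.
move=> _; rewrite poweRyr ?gt_eqF//.
suff -> : \sum_(n <oo) level_term t0 q +oo n = +oo.
  by rewrite gt0_muley// lte_fin powR_gt0.
apply/eqyP => A A0; have [n nA] := level_unbounded (A `^ q^-1) t0_gt0.
apply: (@le_trans _ _ (level_term t0 q +oo n)); last first.
  by apply: nneseries_ge_term => k; exact: level_term_ge0.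
rewrite /level_term ltry lee_fin.
rewrite -[leLHS](@powRr1 _ A) ?(ltW A0)// -(mulVf (lt0r_neq0 q_gt0)) powRrM.
apply: ge0_ler_powR; rewrite ?nnegrE ?powR_ge0 ?(ltW q_gt0)//.
  by rewrite ltW// level_gt0.
exact: ltW.
Qed.

(** A geometric sum of ratio r = 2^q is at most r / (r - 1) times its last term, which is below x^q.
    The constant depends neither on [t0] nor on [x]. *)
Lemma level_series_le q : (0 < q)%R -> exists2 C : R, (0 < C)%R &
  forall t0 x, (0 < t0)%R -> 0 <= x ->
    \sum_(n <oo) level_term t0 q x n <= C%:E * x `^ q.
Proof.
move=> q_gt0; pose r : R := (2 `^ q)%R.
have r_gt1 : (1 < r)%R.
  have <- : (1 `^ q = 1 :> R)%R by rewrite powR1.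
  rewrite /r; apply: gt0_ltr_powR => //; rewrite ?nnegrE//.
  by rewrite ltr1n.
have r1_gt0 : (0 < r - 1)%R by rewrite subr_gt0.
have C_gt0 : (0 < r / (r - 1))%R by rewrite divr_gt0// (lt_trans ltr01).
exists (r / (r - 1))%R => // t0 x t0_gt0; case: x => [y||]//; last first.
  by move=> _; rewrite poweRyr ?gt_eqF// gt0_muley ?leey.
rewrite lee_fin => y0; apply: lime_le.
  by apply: is_cvg_nneseries => n _ _; exact: level_term_ge0.
apply: nearW => /= N; elim: N => [|N IH].
  by rewrite big_geq// -EFinM lee_fin mulr_ge0 ?powR_ge0// ltW.
have [tN|tN] := boolP (level t0 N < y)%R; last first.
  by rewrite big_nat_recr//= {2}/level_term lte_fin (negbTE tN) adde0.
have geo (M : nat) : (\sum_(0 <= k < M) r ^+ k = (r ^+ M - 1) / (r - 1))%R.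
  elim: M => [|M IHM]; first by rewrite big_geq// expr0 subrr mul0r.
  rewrite big_nat_recr//= IHM exprS; field.
  by rewrite gt_eqF.
apply: (@le_trans _ _ (\sum_(0 <= k < N.+1) (level t0 k `^ q)%:E)).
  apply: lee_sum => k _; rewrite /level_term; case: ifPn => //.
  by rewrite lee_fin powR_ge0.
rewrite sumEFin -EFinM lee_fin.
under eq_bigr do rewrite level_powR//.
rewrite -mulr_sumr geo.
apply: (@le_trans _ _ (r / (r - 1) * level t0 N `^ q)%R); last first.
  rewrite ler_wpM2l ?(ltW C_gt0)//; apply: ge0_ler_powR; rewrite ?nnegrE//.
  - exact: ltW.
  - by rewrite ltW// level_gt0.
  - exact: ltW.
rewrite level_powR// -/r exprS.
have -> : (r / (r - 1) * (t0 `^ q * r ^+ N) =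
           t0 `^ q * (r * r ^+ N / (r - 1)))%R by ring.
rewrite ler_wpM2l ?powR_ge0// ler_pM2r ?invr_gt0//.
by rewrite gerBl.
Qed.

(** The factor may be +oo. Then both sides are +oo as soon as one term is positive, and 0
    otherwise. *)
Lemma nneseriesZr_ge0 (u : nat -> \bar R) x : (forall n, 0 <= u n) -> 0 <= x ->
  \sum_(n <oo) u n * x = (\sum_(n <oo) u n) * x.
Proof.
move=> u0; case: x => [y||]// x0.
  rewrite muleC -nneseriesZl//; apply: eq_eseriesr => n _.
  by rewrite muleC.
have [[n un]|no] := pselect (exists n, 0 < u n).
  rewrite gt0_muley; last by apply: (lt_le_trans un); exact: nneseries_ge_term.
  apply/eqP; rewrite -leye_eq.
  rewrite -[leLHS](gt0_muley un).
  by apply: (nneseries_ge_term (u := fun n => u n * +oo)) => k; rewrite mule_ge0.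
have u_eq0 n : u n = 0.
  apply/eqP; rewrite eq_le u0 andbT leNgt; apply/negP => un.
  by apply: no; exists n.
by rewrite !eseries0 ?mul0e// => n *; rewrite u_eq0// mul0e.
Qed.

End dyadic_levels.

(** * Dyadic level sums under the integral sign *)

Section level_integral.
Context d (T : measurableType d) (R : realType).
Variable D : set T.
Hypothesis mD : measurable D.
Implicit Types (m : {measure set T -> \bar R}) (g h : T -> \bar R) (q : R).

Definition superlevel g (t : R) : set T := D `&` [set z | t%:E < g z].

Lemma measurable_superlevel g t : measurable_fun D g ->
  measurable (superlevel g t).
Proof. by move=> mg; exact: emeasurable_fun_o_infty. Qed.

Lemma integral_level_series m q t0 g h : measurable_fun D g ->
  measurable_fun D h -> (forall z, D z -> 0 <= h z) ->
  measurable_fun D (fun z => (\sum_(n <oo) level_term t0 q (g z) n) * h z) /\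
  \sum_(n <oo) (level t0 n `^ q)%:E *
     \int[m]_(z in superlevel g (level t0 n)) h z =
  \int[m]_(z in D) ((\sum_(n <oo) level_term t0 q (g z) n) * h z).
Proof.
move=> mg mh h0.
have mlt n : measurable_fun D (fun z => level_term t0 q (g z) n).
  rewrite /level_term; apply: measurable_fun_if => //.
  apply: (measurable_fun_bool true) => //.
  by rewrite (_ : _ @^-1` _ = [set z | (level t0 n)%:E < g z])//;
    exact: emeasurable_fun_o_infty.
split.
  apply: emeasurable_funM => //; apply: ge0_emeasurable_sum => // n z _ _.
  exact: level_term_ge0.
under [RHS]eq_integral => z zD.
  rewrite -nneseriesZr_ge0; last 2 first.
  - by move=> n; exact: level_term_ge0.
  - by apply: h0; rewrite inE in zD.
  over.
rewrite integral_nneseries//; last 2 first.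
- by move=> n; exact: emeasurable_funM.
- by move=> n z Dz; rewrite mule_ge0 ?level_term_ge0 ?h0.
apply: eq_eseriesr => n _; rewrite integral_mkcondr.
have mP : measurable_fun D (h \_ [set z | (level t0 n)%:E < g z]).
  apply: (@measurable_fun_if _ _ _ _ h (cst 0)) => //.
  - apply: (measurable_fun_bool true) => //.
    rewrite (_ : _ @^-1` _ = [set z | (level t0 n)%:E < g z]).
      exact: emeasurable_fun_o_infty.
    by apply/seteqP; split => z /=; rewrite mem_setE.
  - apply: measurable_funS mh => //; exact: subIsetl.
rewrite -ge0_integralZl//; last 2 first.
- by move=> z Dz; rewrite patchE; case: ifPn => // _; exact: h0.
- by rewrite lee_fin powR_ge0.
apply: eq_integral => z _; rewrite /level_term patchE.
case: ifPn => [|/negP]; rewrite in_setE/= => zP; first by rewrite zP.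
by move/negP/negbTE : zP => ->; rewrite mul0e; exact: mule0.
Qed.

(** No single base level reaches all small values of [g], hence a hypothesis uniform in [t0]. With
    t0 = 1 / (n + 1) it controls the integral over g > t0, and these sets increase to g > 0. Where
    [g] is 0 the integrand vanishes, since q > 0. *)
Lemma level_integral_le m q g h (B : \bar R) : (0 < q)%R ->
  measurable_fun D g -> (forall z, D z -> 0 <= g z) ->
  measurable_fun D h -> (forall z, D z -> 0 <= h z) ->
  (forall t0, (0 < t0)%R ->
    (2 `^ q)%:E * \sum_(n <oo) (level t0 n `^ q)%:E *
      \int[m]_(z in superlevel g (level t0 n)) h z <= B) ->
  \int[m]_(z in D) (g z `^ q * h z) <= B.
Proof.
move=> q_gt0 mg g0 mh h0 HB.
have mgqh : measurable_fun D (fun z => g z `^ q * h z).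
  by apply: emeasurable_funM => //; exact: (measurableT_comp (measurable_poweR q)).
pose t (n : nat) : R := (n.+1%:R^-1)%R.
have t_gt0 n : (0 < t n)%R by rewrite invr_gt0.
have mS n : measurable (superlevel g (t n)) by exact: measurable_superlevel.
have ndS : nondecreasing_seq (fun n => superlevel g (t n)).
  move=> m1 m2 m12; apply/subsetPset => z [Dz /= tz]; split => //=.
  by apply: le_lt_trans tz; rewrite lee_fin lef_pV2 ?posrE// ler_nat ltnS.
have US : \bigcup_n superlevel g (t n) = D `&` [set z | 0 < g z].
  apply/seteqP; split => z.
    by move=> [n _ [Dz /= tz]]; split => //=; apply: lt_trans tz; rewrite lte_fin.
  move=> [Dz /=]; case gz : (g z) => [y||]// y0.
    exists (Num.truncn y^-1) => //; split => //=; rewrite gz lte_fin /t.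
    rewrite lte_fin in y0.
    rewrite -[ltRHS]invrK ltf_pV2 ?posrE ?invr_gt0//; exact: truncnS_gt.
  by exists O => //; split => //=; rewrite gz ltry.
have -> : \int[m]_(z in D) (g z `^ q * h z) =
    \int[m]_(z in \bigcup_n superlevel g (t n)) (g z `^ q * h z).
  rewrite US [RHS]integral_mkcondr; apply: eq_integral => z zD.
  rewrite patchE; case: ifPn => // /negP; rewrite in_setE/= => /negP.
  rewrite -leNgt => gz0.
  have -> : g z = 0 by apply/eqP; rewrite eq_le gz0 g0//; rewrite inE in zD.
  by rewrite poweR0r ?gt_eqF// mul0e.
have fge0 z : D z -> 0 <= g z `^ q * h z.
  by move=> Dz; rewrite mule_ge0 ?poweR_ge0 ?h0.
have mSf n : measurable_fun (superlevel g (t n)) (fun z => g z `^ q * h z).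
  by apply: measurable_funS mgqh => //; exact: subIsetl.
have cvgS := @ge0_nondecreasing_set_cvg_integral _ _ _ _ _ m ndS mS mSf
  (fun n z zS => fge0 z zS.1).
rewrite -(cvg_lim _ cvgS)//; apply: lime_le.
  by apply: ereal_nondecreasing_is_cvgn;
     apply: ge0_nondecreasing_set_nondecreasing_integral => // n z [Dz _];
     exact: fge0.
apply: nearW => n; apply: le_trans (HB (t n) (t_gt0 n)).
have [ms ->] := integral_level_series m q (t n) mg mh h0.
rewrite -ge0_integralZl//; last first.
  move=> z Dz; rewrite mule_ge0 ?h0//; apply: nneseries_ge0 => k _ _.
  exact: level_term_ge0.
have ser_ge0 z : D z ->
    0 <= (2 `^ q)%:E * ((\sum_(k <oo) level_term (t n) q (g z) k) * h z).
  move=> Dz; rewrite !mule_ge0 ?h0 ?lee_fin ?powR_ge0//.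
  by apply: nneseries_ge0 => k _ _; exact: level_term_ge0.
have mser : measurable_fun D (fun z =>
    (2 `^ q)%:E * ((\sum_(k <oo) level_term (t n) q (g z) k) * h z)).
  exact: measurable_funeM.
apply: (@le_trans _ _ (\int[m]_(z in superlevel g (t n))
    ((2 `^ q)%:E * ((\sum_(k <oo) level_term (t n) q (g z) k) * h z)))).
  apply: ge0_le_integral => //.
  - by move=> z [Dz _]; exact: fge0.
  - by apply: measurable_funS mser => //; exact: subIsetl.
  - move=> z [Dz tz]; rewrite muleA; apply: lee_wpmul2r; first exact: h0.
    exact: le_level_series.
apply: ge0_subset_integral => //; exact: subIsetl.
Qed.

Lemma level_integral_ge m q : (0 < q)%R ->
  exists2 C : R, (0 < C)%R & forall g h t0, (0 < t0)%R ->
  measurable_fun D g -> (forall z, D z -> 0 <= g z) ->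
  measurable_fun D h -> (forall z, D z -> 0 <= h z) ->
  \sum_(n <oo) (level t0 n `^ q)%:E *
    \int[m]_(z in superlevel g (level t0 n)) h z
  <= C%:E * \int[m]_(z in D) (g z `^ q * h z).
Proof.
move=> q_gt0; have [C C_gt0 HC] := level_series_le q_gt0.
exists C => // g h t0 t0_gt0 mg g0 mh h0.
have mgqh : measurable_fun D (fun z => g z `^ q * h z).
  by apply: emeasurable_funM => //; exact: (measurableT_comp (measurable_poweR q)).
have [ms ->] := integral_level_series m q t0 mg mh h0.
rewrite -ge0_integralZl//; last 2 first.
- by move=> z Dz; rewrite mule_ge0 ?poweR_ge0 ?h0.
- by rewrite lee_fin ltW.
apply: ge0_le_integral => //.
- move=> z Dz; rewrite mule_ge0 ?h0//; apply: nneseries_ge0 => k _ _.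
  exact: level_term_ge0.
- exact: measurable_funeM.
- move=> z Dz; rewrite muleA; apply: lee_wpmul2r; first exact: h0.
  by apply: HC => //; exact: g0.
Qed.

End level_integral.

(** There are two measurable types because [mu] and the product Lebesgue measure carry different
    displays. Unequal exponents serve the necessity, where the weak bound has a spare factor t on
    one side. *)
Lemma level_integral_compare d1 (T1 : measurableType d1) d2 (T2 : measurableType d2)
    (R : realType) (m1 : {measure set T1 -> \bar R}) (m2 : {measure set T2 -> \bar R})
    (D1 : set T1) (D2 : set T2) (q1 q2 a : R) :
  measurable D1 -> measurable D2 -> (0 < q1)%R -> (0 < q2)%R -> (0 < a)%R ->
  exists2 C : R, (0 < C)%R & forall g1 h1 g2 h2,
  measurable_fun D1 g1 -> (forall z, D1 z -> 0 <= g1 z) ->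
  measurable_fun D1 h1 -> (forall z, D1 z -> 0 <= h1 z) ->
  measurable_fun D2 g2 -> (forall z, D2 z -> 0 <= g2 z) ->
  measurable_fun D2 h2 -> (forall z, D2 z -> 0 <= h2 z) ->
  (forall t, (0 < t)%R ->
    (t `^ q1)%:E * \int[m1]_(z in superlevel D1 g1 t) h1 z <=
    a%:E * ((t `^ q2)%:E * \int[m2]_(z in superlevel D2 g2 t) h2 z)) ->
  \int[m1]_(z in D1) (g1 z `^ q1 * h1 z) <=
  C%:E * \int[m2]_(z in D2) (g2 z `^ q2 * h2 z).
Proof.
move=> mD1 mD2 q1_gt0 q2_gt0 a_gt0.
have [C C_gt0 HC] := level_integral_ge mD2 m2 q2_gt0.
exists (2 `^ q1 * (a * C))%R; first by rewrite !mulr_gt0// powR_gt0.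
move=> g1 h1 g2 h2 mg1 g10 mh1 h10 mg2 g20 mh2 h20 H.
apply: level_integral_le => // t0 t0_gt0.
rewrite EFinM -muleA; apply: lee_wpmul2l; first by rewrite lee_fin powR_ge0.
rewrite EFinM -muleA.
apply: (@le_trans _ _ (a%:E * \sum_(n <oo) (level t0 n `^ q2)%:E *
    \int[m2]_(z in superlevel D2 g2 (level t0 n)) h2 z)); last first.
  by apply: lee_wpmul2l; [rewrite lee_fin ltW|exact: HC].
rewrite -nneseriesZl; last first.
  move=> n _; rewrite mule_ge0 ?lee_fin ?powR_ge0//.
  by apply: integral_ge0 => z [Dz _]; exact: h20.
apply: lee_nneseries => [n _ _|n _]; last by apply: H; exact: level_gt0.
rewrite mule_ge0 ?lee_fin ?powR_ge0//.
by apply: integral_ge0 => z [Dz _]; exact: h10.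
Qed.

(** * Doubling of the weighted volume *)

Section volume.
Context {R : realType}.
Variable alpha : R.
Hypothesis alpha_gtN1 : (-1 < alpha)%R.

Local Notation lam := (@lebesgue_measure R).

Let alpha1_gt0 : (0 < alpha + 1)%R.
Proof. by move: alpha_gtN1; lra. Qed.

Lemma integral_powR_itv (a b : R) : (0 < a)%R -> (a < b)%R ->
  \int[lam]_(y in `]a, b[) (y `^ alpha)%:E =
  ((b `^ (alpha + 1) - a `^ (alpha + 1)) / (alpha + 1))%:E.
Proof.
move=> a_gt0 ab.
have ab_gt0 (x : R) : x \in `[a, b] -> (0 < x)%R.
  by rewrite in_itv/= => /andP[+ _]; exact: lt_le_trans.
pose F (x : R) : R := ((alpha + 1)^-1 * x `^ (alpha + 1))%R.
have dF (x : R) : (0 < x)%R -> is_derive x 1%R F (x `^ alpha)%R.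
  move=> x_gt0; have h := is_derive1_powR (alpha + 1) x_gt0.
  have := is_deriveZ (alpha + 1)^-1 h; rewrite addrK => h2.
  apply: (is_derive_eq h2); rewrite /GRing.scale/=; field.
  by rewrite gt_eqF.
have cF (x : R) : (0 < x)%R -> {for x, continuous F}.
  move=> /dF h; apply: differentiable_continuous.
  exact/derivable1_diffP/ex_derive.
rewrite -(@integral_itv_bndoo _ _ _ _ true false); last first.
  apply: measurable_funTS; apply/measurable_EFinP; exact: measurable_powR.
rewrite (@continuous_FTC2 _ _ F)//.
- by rewrite /F -EFinB -mulrBr mulrC.
- apply: derivable_within_continuous => x /ab_gt0 x_gt0.
  by apply: derivable_powR; rewrite in_itv/= x_gt0.
- split.
  + move=> x xab; have h := dF x (ab_gt0 x (subset_itv_oo_cc xab)).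
    exact: ex_derive.
  + by apply: cvg_at_right_filter; apply: cF.
  + by apply: cvg_at_left_filter; apply: cF; apply: lt_trans ab.
- move=> x xab; rewrite derive1E; have h := dF x (ab_gt0 x (subset_itv_oo_cc xab)).
  exact: derive_val.
Qed.

Lemma measurable_powR_EFin (D : set R) : measurable_fun D (fun y : R => (y `^ alpha)%:E).
Proof. by apply: measurable_funTS; apply/measurable_EFinP; exact: measurable_powR. Qed.

(** The integrand may blow up at 0, so ]0, L[ is exhausted by ]L / (n + 2), L[; the shift by 2 keeps
    the first of them nonempty. As alpha + 1 > 0, the primitive at the lower endpoint enters with a
    favourable sign. *)
Lemma integral_powR_le (L : R) : (0 < L)%R ->
  \int[lam]_(y in `]0%R, L[) (y `^ alpha)%:E <=
  (L `^ (alpha + 1) / (alpha + 1))%:E.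
Proof.
move=> L_gt0; pose a (n : nat) : R := (L / n.+2%:R)%R.
have a_gt0 n : (0 < a n)%R by rewrite divr_gt0.
have aL n : (a n < L)%R by rewrite /a gtr_pMr// invf_lt1// ltr1n.
pose F n : set R := `]a n, L[%classic.
have -> : `]0%R, L[%classic = \bigcup_n F n.
  apply/seteqP; split => x; last first.
    move=> [n _]; rewrite /F/= !in_itv/= => /andP[ax ->].
    by rewrite (lt_trans _ ax).
  rewrite /= in_itv/= => /andP[x0 xL]; exists (Num.truncn (L / x)) => //.
  rewrite /F/= in_itv/= xL andbT /a ltr_pdivrMr// mulrC -ltr_pdivrMr//.
  apply: lt_le_trans (truncnS_gt _) _.
  by rewrite ler_nat.
have ndF : nondecreasing_seq F.
  move=> n m nm; apply/subsetPset => x; rewrite /F/= !in_itv/= => /andP[ax ->].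
  rewrite andbT; apply: le_lt_trans ax.
  by rewrite /a ler_pM2l// lef_pV2 ?posrE// ler_nat.
have F0 n x : F n x -> 0 <= (x `^ alpha)%:E by move=> _; rewrite lee_fin powR_ge0.
have mF n : measurable (F n) by exact: measurable_itv.
have cvgF := @ge0_nondecreasing_set_cvg_integral _ _ _ _ _ lam ndF mF
  (fun n => @measurable_powR_EFin (F n)) F0.
rewrite -(cvg_lim _ cvgF)//; apply: lime_le.
  apply: ereal_nondecreasing_is_cvgn.
  apply: ge0_nondecreasing_set_nondecreasing_integral => //.
  by move=> n; exact: measurable_powR_EFin.
apply: nearW => n; rewrite integral_powR_itv// lee_fin.
by rewrite ler_pM2r ?invr_gt0// gerBl powR_ge0.
Qed.

(** The upper half ]L / 2, L[ already carries a mass of order L^(alpha + 1). *)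
Lemma integral_powR_ge : exists2 c : R, (0 < c)%R & forall L : R, (0 < L)%R ->
  (c * L `^ (alpha + 1))%:E <= \int[lam]_(y in `]0%R, L[) (y `^ alpha)%:E.
Proof.
pose h : R := (2^-1 `^ (alpha + 1))%R.
have h_lt1 : (h < 1)%R.
  have <- : (1 `^ (alpha + 1) = 1 :> R)%R by rewrite powR1.
  apply: gt0_ltr_powR => //; rewrite ?nnegrE//.
  by rewrite invf_lt1// ltr1n.
exists ((1 - h) / (alpha + 1))%R; first by rewrite divr_gt0// subr_gt0.
move=> L L_gt0; have L2 : (L / 2 < L)%R by lra.
apply: (@le_trans _ _ (\int[lam]_(y in `](L / 2)%R, L[) (y `^ alpha)%:E)).
  rewrite integral_powR_itv ?divr_gt0// lee_fin (@powRM _ L)//; last exact: ltW.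
  by rewrite -/h le_eqVlt; apply/orP; left; apply/eqP; ring.
apply: ge0_subset_integral => //.
- exact: measurable_powR_EFin.
- by move=> x _; rewrite lee_fin powR_ge0.
- by apply: subset_itvr; rewrite bnd_simp divr_ge0// ltW.
Qed.

Lemma volume_carleson (I : set R) : bounded_itv I ->
  volume alpha (carleson I) =
  (len I)%:E * \int[lam]_(y in `]0%R, len I[) (y `^ alpha)%:E.
Proof.
move=> bI; rewrite /volume /int_dV/=.
under eq_integral do rewrite mul1e.
have mI := bounded_itv_measurable bI.
have mQ := measurable_carleson bI.
have mf : measurable_fun setT (fun z : R * R => (z.2 `^ alpha)%:E).
  apply/measurable_EFinP; apply: (measurableT_comp (measurable_powR alpha)).
  exact: measurable_snd.
rewrite integral_mkcond fubini_tonelli1; last 2 first.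
- by apply/(measurable_restrictT _ mQ); exact: measurable_funTS.
- by move=> z; apply: erestrict_ge0 => w _; exact: powR_ge0.
set V : \bar R := \int[lam]_(y in `]0%R, len I[) (y `^ alpha)%:E.
have V0 : 0 <= V by apply: integral_ge0 => y _; rewrite lee_fin powR_ge0.
transitivity (\int[lam]_(x in I) V); last first.
  rewrite integral_cst// -(lebesgue_measure_bounded_itv bI).
  exact: muleC.
rewrite [RHS]integral_mkcond; apply: eq_integral => x _.
rewrite /fubini_F [RHS]patchE; case: ifPn => [|/negP]; rewrite in_setE => Ix.
  rewrite /V [RHS]integral_mkcond; apply: eq_integral => y _.
  rewrite !patchE/=; congr (if _ then _ else _); apply/idP/idP; rewrite !inE.
    by move=> /(carlesonP _ bI)/= [_ y0 yL]; rewrite /= in_itv/= y0.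
  by rewrite /= in_itv/= => /andP[y0 yL]; apply/(carlesonP _ bI).
rewrite integral0_eq// => y _; rewrite patchE; case: ifPn => //.
by rewrite inE => -[].
Qed.

Lemma volume_carleson_gt0 (I : set R) : bounded_itv I ->
  exists2 v : R, (0 < v)%R & volume alpha (carleson I) = v%:E.
Proof.
move=> bI; have L_gt0 := len_gt0 bI; have [c c_gt0 Hc] := integral_powR_ge.
have := Hc _ L_gt0; have := integral_powR_le L_gt0; rewrite volume_carleson//.
case: (\int[lam]_(_ in _) _) => [V||]//= _; rewrite lee_fin => cV.
exists (len I * V)%R => //; rewrite mulr_gt0//.
by apply: lt_le_trans cV; rewrite mulr_gt0// powR_gt0.
Qed.

Lemma volume_doubling : exists2 C : R, (0 < C)%R & forall I : set R,
  bounded_itv I -> volume alpha (carleson (star I)) <=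
                   C%:E * volume alpha (carleson I).
Proof.
have [c c_gt0 Hc] := integral_powR_ge.
(* One factor 5 comes from the base, 5^(alpha + 1) from the height, and the rest is the quotient of
   the upper by the lower bound for the vertical integral. *)
exists (5 * 5 `^ (alpha + 1) / (alpha + 1) / c)%R.
  by rewrite !divr_gt0// mulr_gt0// powR_gt0.
move=> I bI; have L_gt0 := len_gt0 bI.
rewrite !volume_carleson//; last exact: bounded_star.
rewrite len_star//; set L := len I in L_gt0 *.
apply: (@le_trans _ _ ((5 * L)%:E *
    ((5 * L) `^ (alpha + 1) / (alpha + 1))%:E)).
  apply: lee_wpmul2l; first by rewrite lee_fin mulr_ge0// ltW.
  by apply: integral_powR_le; rewrite mulr_gt0.
rewrite muleCA -EFinM (powRM _ _ (ltW L_gt0))//.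
apply: (@le_trans _ _ (L%:E * ((5 * 5 `^ (alpha + 1) / (alpha + 1) / c)%:E *
    (c * L `^ (alpha + 1))%:E))).
  rewrite -!EFinM lee_fin le_eqVlt; apply/orP; left; apply/eqP; field.
  by rewrite !gt_eqF.
apply: lee_wpmul2l; first by rewrite lee_fin ltW.
apply: lee_wpmul2l; last exact: Hc.
by rewrite lee_fin !divr_ge0 ?mulr_ge0 ?powR_ge0// ltW.
Qed.

End volume.

(** * Weighted volume of Carleson squares for a Bekolle-Bonami weight *)

Section weighted_volume.
Context {R : realType}.
Variables (alpha r : R) (omega : R * R -> R).
Hypothesis alpha_gtN1 : (-1 < alpha)%R.
Hypothesis r_gt1 : (1 < r)%R.
Hypothesis weight_omega : weight omega.
Hypothesis BB_omega : BB_class r omega alpha.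

Local Notation lam2 := (@lebesgue_measure R \x @lebesgue_measure R)%E.

(** Since s = r' - 1 = 1 / (r - 1), the function [sigma] is the dual weight omega^(1 - r'), with
    value +oo where omega vanishes. *)
Let s : R := (conjugate_exponent r - 1)%R.

Let sigma (z : R * R) : \bar R := ((omega z `^ s)%:E)^-1.

Let s_gt0 : (0 < s)%R.
Proof.
rewrite /s /conjugate_exponent.
have -> : (r / (r - 1) - 1 = (r - 1)^-1)%R.
  by field; rewrite gt_eqF// subr_gt0.
by rewrite invr_gt0 subr_gt0.
Qed.

Let sr : (s * (r - 1) = 1)%R.
Proof.
rewrite /s /conjugate_exponent; field.
by rewrite gt_eqF// subr_gt0.
Qed.

Lemma measurable_height : measurable_fun setT (fun z : R * R => (z.2 `^ alpha)%:E).
Proof.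
apply/measurable_EFinP; apply: (measurableT_comp (measurable_powR alpha)).
exact: measurable_snd.
Qed.

Lemma measurable_weightE : measurable_fun upper_half (EFin \o omega).
Proof. by case: weight_omega => /measurable_EFinP. Qed.

Let sigmaE z : upper_half z ->
  sigma z = if omega z == 0%R then +oo else (omega z `^ (- s))%:E.
Proof.
move=> z0; rewrite /sigma; case: eqP => [->|/eqP w0].
  by rewrite powR0 ?gt_eqF// inve0.
by rewrite inver powR_eq0 (negbTE w0)/= powRN.
Qed.

Let measurable_sigma : measurable_fun upper_half sigma.
Proof.
apply: (eq_measurable_fun
    (fun z => if omega z == 0%R then +oo else (omega z `^ (- s))%:E)).
  by move=> z; rewrite in_setE => /sigmaE.
have mw : measurable_fun upper_half omega by case: weight_omega.
apply: (measurable_fun_if measurable_upper_half) => //.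
- by apply: measurable_fun_eqr.
- apply/measurable_EFinP; apply: (measurableT_comp (measurable_powR _)).
  apply: measurable_funS mw; first exact: measurable_upper_half.
  exact: subIsetl.
Qed.

Let sigma_ge0 z : 0 <= sigma z.
Proof. by rewrite /sigma inve_ge0 lee_fin powR_ge0. Qed.

Lemma int_dV_ge0 (E : set (R * R)) (g : R * R -> \bar R) :
  (forall z, E z -> 0 <= g z) -> 0 <= int_dV alpha E g.
Proof.
move=> g0; apply: integral_ge0 => z Ez.
by rewrite mule_ge0 ?g0// lee_fin powR_ge0.
Qed.

Lemma measurable_int_dV (E : set (R * R)) (g : R * R -> \bar R) :
  E `<=` upper_half -> measurable E -> measurable_fun upper_half g ->
  measurable_fun E (fun z => g z * (z.2 `^ alpha)%:E).
Proof.
move=> ED mE mg; apply: emeasurable_funM; last first.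
  exact: measurable_funTS measurable_height.
by apply: measurable_funS mg => //; exact: measurable_upper_half.
Qed.

Lemma int_dV_subset (E F : set (R * R)) (g : R * R -> \bar R) :
  measurable E -> measurable F -> E `<=` F -> F `<=` upper_half ->
  measurable_fun upper_half g -> (forall z, F z -> 0 <= g z) ->
  int_dV alpha E g <= int_dV alpha F g.
Proof.
move=> mE mF EF FD mg g0; apply: ge0_subset_integral => //.
  exact: measurable_int_dV.
by move=> z Fz; rewrite mule_ge0 ?g0// lee_fin powR_ge0.
Qed.

Let omega_ge0 z : upper_half z -> (0 <= omega z)%R.
Proof. by case: weight_omega => _ + _; apply. Qed.

(* For every [e > 0], either [e * omega >= 1] or [(e * omega)^(1-r') >= 1];
   this replaces Hoelder's inequality. *)
Let one_le_split (e : R) z : (0 < e)%R -> upper_half z ->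
  1 <= e%:E * (omega z)%:E + (e `^ (- s))%:E * sigma z.
Proof.
move=> e0 Dz; have w0 := omega_ge0 Dz; rewrite sigmaE//.
case: eqP => [->|/eqP wn0].
  by rewrite mule0 add0e gt0_muley ?leey// lte_fin powR_gt0.
have {wn0}w0' : (0 < omega z)%R by rewrite lt_neqAle eq_sym wn0.
rewrite -!EFinM -EFinD lee_fin -powRM ?(ltW e0)//.
have [h|h] := leP 1%R (e * omega z)%R.
  by rewrite (le_trans h)// lerDl powR_ge0.
apply: (@le_trans _ _ ((e * omega z) `^ (- s))%R); last first.
  by rewrite lerDr mulr_ge0// ltW.
rewrite powRN -[leLHS]invr1 lef_pV2 ?posrE ?powR_gt0 ?mulr_gt0//.
have {1}<- : (1 `^ s = 1 :> R)%R by rewrite powR1.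
apply: ge0_ler_powR; rewrite ?nnegrE ?(ltW h) ?(ltW s_gt0)//.
by rewrite mulr_ge0// ltW.
Qed.

(** [one_le_split] integrated over Q_I. The [sigma] term is enlarged to Q_J so that the same
    integral occurs in the Bekolle-Bonami bound on Q_J. *)
Let volume_le (e : R) (I J : set R) : bounded_itv I -> bounded_itv J ->
  I `<=` J -> (0 < e)%R ->
  volume alpha (carleson I) <= e%:E * wvolume omega alpha (carleson I) +
    (e `^ (- s))%:E * int_dV alpha (carleson J) sigma.
Proof.
move=> bI bJ IJ e0; have mI := measurable_carleson bI.
have ID := @carleson_upper_half R I.
have wvE : e%:E * wvolume omega alpha (carleson I) =
    \int[lam2]_(z in carleson I) (e%:E * ((omega z)%:E * (z.2 `^ alpha)%:E)).
  rewrite ge0_integralZl//.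
  - exact: (measurable_int_dV ID mI measurable_weightE).
  - by move=> z /ID Dz; rewrite -EFinM lee_fin mulr_ge0 ?powR_ge0// omega_ge0.
  - by rewrite lee_fin ltW.
have sE : (e `^ (- s))%:E * int_dV alpha (carleson I) sigma =
    \int[lam2]_(z in carleson I) ((e `^ (- s))%:E * (sigma z * (z.2 `^ alpha)%:E)).
  rewrite ge0_integralZl//.
  - exact: (measurable_int_dV ID mI measurable_sigma).
  - by move=> z _; rewrite mule_ge0// lee_fin powR_ge0.
  - by rewrite lee_fin powR_ge0.
apply: (@le_trans _ _ (e%:E * wvolume omega alpha (carleson I) +
    (e `^ (- s))%:E * int_dV alpha (carleson I) sigma)); last first.
  apply: leeD => //; apply: lee_wpmul2l; first by rewrite lee_fin powR_ge0.
  apply: int_dV_subset => //; [exact: measurable_carleson|exact: carleson_sub|].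
  exact: carleson_upper_half.
rewrite wvE sE -ge0_integralD//; last 4 first.
- move=> z /ID Dz; rewrite -!EFinM lee_fin !mulr_ge0 ?powR_ge0 ?omega_ge0//.
  exact: ltW.
- apply: measurable_funeM.
  exact: (measurable_int_dV ID mI measurable_weightE).
- by move=> z _; rewrite !mule_ge0// lee_fin powR_ge0.
- apply: measurable_funeM.
  exact: (measurable_int_dV ID mI measurable_sigma).
apply: ge0_le_integral => //.
- by move=> z _; rewrite mul1e lee_fin powR_ge0.
- apply: measurable_int_dV => //; exact: measurable_cst.
- apply: emeasurable_funD; apply: measurable_funeM.
    exact: (measurable_int_dV ID mI measurable_weightE).
  exact: (measurable_int_dV ID mI measurable_sigma).
- move=> z /ID Dz; rewrite !muleA -ge0_muleDl.
  + apply: lee_wpmul2r; first by rewrite lee_fin powR_ge0.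
    exact: one_le_split.
  + by rewrite -EFinM lee_fin mulr_ge0 ?omega_ge0// ltW.
  + by rewrite mule_ge0// lee_fin powR_ge0.
Qed.

Let BB_bound : exists2 B : R, (0 < B)%R & forall J, bounded_itv J ->
  (wvolume omega alpha (carleson J) / volume alpha (carleson J)) *
  (int_dV alpha (carleson J) sigma / volume alpha (carleson J)) `^ (r - 1)
  <= B%:E.
Proof.
move: BB_omega; rewrite /BB_class => Blt.
have : exists2 B : R, (0 < B)%R & BB_constant r omega alpha <= B%:E.
  case: (BB_constant r omega alpha) Blt => [b||]// _; last first.
    by exists 1%R => //; exact: leNye.
  exists (`|b| + 1)%R; first by rewrite ltr_wpDl.
  by rewrite lee_fin (le_trans (ler_norm _))// lerDl.
move=> [B B0 HB]; exists B => // J bJ; apply: le_trans HB.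
by apply: ereal_sup_ubound; exists J.
Qed.

Let wvolume_ge0 J : 0 <= wvolume omega alpha (carleson J).
Proof.
by apply: int_dV_ge0 => z /carleson_upper_half Dz; rewrite lee_fin omega_ge0.
Qed.

(** An infinite average of [sigma] is compatible with a finite constant only through 0 * +oo = 0. *)
Let wvolume_eq0 J : bounded_itv J ->
  int_dV alpha (carleson J) sigma = +oo ->
  wvolume omega alpha (carleson J) = 0.
Proof.
move=> bJ SJ; have [B B0 HB] := BB_bound.
have [v v0 vE] := volume_carleson_gt0 alpha_gtN1 bJ.
have := HB _ bJ; rewrite SJ vE inver gt_eqF//.
rewrite gt0_mulye ?lte_fin ?invr_gt0// poweRyr ?subr_eq0 ?gt_eqF//.
have := wvolume_ge0 J; rewrite le_eqVlt => /predU1P[<-//|w0].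
rewrite gt0_muley ?leye_eq//.
by rewrite mule_gt0// lte_fin invr_gt0.
Qed.

(** The value of e for which e^(-s) * S = v / 2, because s * (r - 1) = 1: the [sigma] term of
    [volume_le] then uses up only half of the volume. *)
Let scale (S v : R) : R := ((2 * S / v) `^ (r - 1))%R.

Let wvolume_lower (S v : R) (I J : set R) : bounded_itv I -> bounded_itv J ->
  I `<=` J -> volume alpha (carleson I) = v%:E -> (0 < v)%R -> (0 < S)%R ->
  int_dV alpha (carleson J) sigma = S%:E ->
  (v / 2)%:E <= (scale S v)%:E * wvolume omega alpha (carleson I).
Proof.
move=> bI bJ IJ vE v0 S0 SE.
have x0 : (0 < 2 * S / v)%R by rewrite !mulr_gt0// invr_gt0.
have := volume_le bI bJ IJ (powR_gt0 (r - 1) x0).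
rewrite vE SE -/(scale S v) -powRrM mulrN [((r - 1) * s)%R]mulrC sr powRN.
rewrite powRr1 ?(ltW x0)// -EFinM.
have -> : ((2 * S / v)^-1 * S = v / 2)%R by field; rewrite !gt_eqF.
rewrite -leeBlDr// -EFinB.
by have -> : (v - v / 2 = v / 2)%R by field.
Qed.

(** Without the [sigma] term, [volume_le] bounds a fixed positive volume by e * w(Q_I) for every e >
    0. *)
Let wvolume_infty (I J : set R) : bounded_itv I -> bounded_itv J ->
  I `<=` J -> int_dV alpha (carleson J) sigma = 0 ->
  wvolume omega alpha (carleson I) = +oo.
Proof.
move=> bI bJ IJ SE; have [v v0 vE] := volume_carleson_gt0 alpha_gtN1 bI.
have := @volume_le _ I J bI bJ IJ; rewrite vE SE.
have := wvolume_ge0 I; case: (wvolume _ _ _) => [w||]//; rewrite lee_fin => w0 H.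
have e0 : (0 < v / (2 * (w + 1)))%R by rewrite divr_gt0// mulr_gt0// ltr_wpDl.
have := H _ e0; rewrite mule0 adde0 -EFinM lee_fin leNgt => /negP[].
have w1 : (w / (w + 1) < 1)%R by rewrite ltr_pdivrMr ?mul1r ?ltrDl// ltr_wpDl.
have -> : (v / (2 * (w + 1)) * w = v * (w / (w + 1)) / 2)%R.
  by field; rewrite gt_eqF// ltr_wpDl.
rewrite ltr_pdivrMr// ltr_pM2l//; apply: lt_trans w1 _.
by rewrite ltr1n.
Qed.

(** Let S be the [sigma] integral over Q_J with J = [star I], and v, v' the volumes of Q_I, Q_J. The
    class bounds w(Q_J) above by B v' (v' / S)^(r - 1), and [wvolume_lower] bounds w(Q_I) below by
    (v / 2) (2 S / v)^(-(r - 1)). In the quotient S cancels and only v' / v <= C0 remains. *)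
Lemma wvolume_doubling : exists2 C : R, (0 < C)%R & forall I, bounded_itv I ->
  wvolume omega alpha (carleson (star I)) <=
  C%:E * wvolume omega alpha (carleson I).
Proof.
have [B B0 HB] := BB_bound.
have [C0 C00 HC0] := volume_doubling alpha_gtN1.
exists (2 * B * C0 * (2 * C0) `^ (r - 1))%R.
  by rewrite !mulr_gt0// powR_gt0// mulr_gt0.
set C := (2 * B * _ * _)%R.
have C_gt0 : (0 < C)%R by rewrite !mulr_gt0// powR_gt0// mulr_gt0.
move=> I bI; set J := star I.
have bJ : bounded_itv J by exact: bounded_star.
have IJ : I `<=` J by exact: sub_star.
have [v v0 vE] := volume_carleson_gt0 alpha_gtN1 bI.
have [v' v'0 v'E] := volume_carleson_gt0 alpha_gtN1 bJ.
have v'v : (v' <= C0 * v)%R.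
  by have := HC0 _ bI; rewrite -/J vE v'E -EFinM lee_fin.
have S0 : 0 <= int_dV alpha (carleson J) sigma by exact: int_dV_ge0.
case SE : (int_dV alpha (carleson J) sigma) => [S||]; last 2 first.
- by rewrite (wvolume_eq0 bJ SE) mule_ge0// lee_fin ltW.
- by move: S0; rewrite SE.
move: S0; rewrite SE lee_fin le_eqVlt => /predU1P[S0|S0].
  rewrite (wvolume_infty bI bJ IJ).
    by rewrite gt0_muley ?lte_fin// leey.
  by rewrite SE -S0.
have := wvolume_lower bI bJ IJ vE v0 S0 SE.
have := HB _ bJ; rewrite SE v'E inver gt_eqF// -EFinM poweR_EFin.
have Sv'0 : (0 < (S / v') `^ (r - 1))%R by rewrite powR_gt0// divr_gt0.
have := wvolume_ge0 I; case: (wvolume _ _ (carleson I)) => [w||]//; last first.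
  by move=> _ _ _; rewrite gt0_muley ?lte_fin// leey.
rewrite lee_fin => w0.
have := wvolume_ge0 J; case: (wvolume _ _ (carleson J)) => [w'||]//; last first.
  by move=> _; rewrite gt0_mulye ?gt0_mulye ?lte_fin ?invr_gt0//.
rewrite lee_fin => w'0; rewrite -!EFinM !lee_fin /scale => H1 H2.
have w'le : (w' <= B * v' * (v' / S) `^ (r - 1))%R.
  have AA' : ((S / v') `^ (r - 1) * (v' / S) `^ (r - 1) = 1)%R.
    rewrite -powRM ?divr_ge0 ?(ltW v'0) ?(ltW S0)//.
    have -> : (S / v' * (v' / S) = 1)%R by field; rewrite !gt_eqF.
    by rewrite powR1.
  have -> : (w' = w' / v' * (S / v') `^ (r - 1) * (v' * (v' / S) `^ (r - 1)))%R.
    transitivity (w' / v' * v' * ((S / v') `^ (r - 1) * (v' / S) `^ (r - 1)))%R.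
      by rewrite AA' mulr1 divfK// gt_eqF.
    by ring.
  by rewrite -[leRHS]mulrA ler_wpM2r// mulr_ge0 ?powR_ge0// ltW.
apply: (le_trans w'le).
(* The lower bound for w(Q_I), normalised into a factor at least 1 that can be multiplied in. *)
have H3 : (1 <= (2 * S / v) `^ (r - 1) * w * (2 / v))%R.
  have v2 : (0 <= 2 / v)%R by rewrite divr_ge0// ltW.
  have := ler_wpM2r v2 H2.
  by have -> : (v / 2 * (2 / v) = 1)%R by field; rewrite gt_eqF.
apply: (@le_trans _ _ (B * v' * (v' / S) `^ (r - 1) *
    ((2 * S / v) `^ (r - 1) * w * (2 / v)))%R).
  by rewrite ler_peMr// !mulr_ge0 ?powR_ge0// ltW.
have -> : (B * v' * (v' / S) `^ (r - 1) *
    ((2 * S / v) `^ (r - 1) * w * (2 / v)) =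
    2 * B * (v' / v) * ((v' / S) `^ (r - 1) * (2 * S / v) `^ (r - 1)) * w)%R.
  by field; rewrite gt_eqF.
rewrite -powRM ?divr_ge0 ?mulr_ge0 ?(ltW v'0) ?(ltW S0) ?(ltW v0)//.
have -> : (v' / S * (2 * S / v) = 2 * (v' / v))%R.
  by field; rewrite !gt_eqF.
have v'v0 : (v' / v <= C0)%R by rewrite ler_pdivrMr.
have vv0 : (0 <= v' / v)%R by rewrite divr_ge0 ?(ltW v'0) ?(ltW v0).
rewrite ler_wpM2r// /C; apply: ler_pM.
- by rewrite mulr_ge0// mulr_ge0// ltW.
- exact: powR_ge0.
- by rewrite ler_pM2l// mulr_gt0.
apply: ge0_ler_powR.
- by rewrite subr_ge0 ltW.
- by rewrite nnegrE mulr_ge0.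
- by rewrite nnegrE mulr_ge0// ltW.
- by rewrite ler_pM2l.
Qed.

Let sigma_infty_sub (I J : set R) : bounded_itv I -> bounded_itv J ->
  I `<=` J -> int_dV alpha (carleson I) sigma <= int_dV alpha (carleson J) sigma.
Proof.
move=> bI bJ IJ; apply: int_dV_subset => //.
- exact: measurable_carleson.
- exact: measurable_carleson.
- exact: carleson_sub.
- exact: carleson_upper_half.
Qed.

(** [sigma] is positive at every point of the half-plane, because omega is finite there; a zero
    integral would force the volume of Q_J to be 0. *)
Let sigma_neq0 J : bounded_itv J -> int_dV alpha (carleson J) sigma != 0.
Proof.
move=> bJ; apply/eqP => SJ; have mJ := measurable_carleson bJ.
have JD := @carleson_upper_half R J.
have [v v0 vE] := volume_carleson_gt0 alpha_gtN1 bJ.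
have msJ := measurable_int_dV JD mJ measurable_sigma.
have : ae_eq lam2 (carleson J) (fun z => sigma z * (z.2 `^ alpha)%:E) (cst 0).
  apply/ae_eq_integral_abs => //; rewrite -[RHS]SJ; apply: eq_integral => z _.
  by rewrite gee0_abs// mule_ge0// lee_fin powR_ge0.
move=> ae0; have : volume alpha (carleson J) = 0.
  rewrite /volume /int_dV -(@integral0 _ _ _ lam2 (carleson J)).
  apply: ge0_ae_eq_integral => //.
  - by apply: measurable_int_dV => //; exact: measurable_cst.
  - by move=> z _; rewrite mul1e lee_fin powR_ge0.
  apply: filterS ae0 => z + Jz => /(_ Jz)/eqP; rewrite mule_eq0 => /orP[|/eqP ->].
    rewrite sigmaE; last exact: JD.
    case: ifPn => [//|w0].
    by rewrite eqe powR_eq0 (negbTE w0).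
  by rewrite mule0.
by rewrite vE => /eqP; rewrite eqe gt_eqF.
Qed.

(** If [sigma] has infinite integral over one large square, it does over all larger ones; by
    [wvolume_eq0] they have weighted volume 0, and they exhaust the half-plane. Otherwise the
    integral of [sigma] is finite and positive on each square, so the class makes w(Q_I) finite and
    [wvolume_lower] makes it positive. *)
Lemma wvolume_dichotomy : wvolume omega alpha upper_half = 0 \/
  forall I, bounded_itv I -> exists2 w : R, (0 < w)%R &
    wvolume omega alpha (carleson I) = w%:E.
Proof.
have [[n Sn]|no] := pselect (exists n, int_dV alpha (carleson (big_itv n)) sigma = +oo).
  left.
  have S_eqy m : int_dV alpha (carleson (big_itv (n + m))) sigma = +oo.
    apply/eqP; rewrite -leye_eq -Sn; apply: sigma_infty_sub.
    - exact: bounded_big_itv.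
    - exact: bounded_big_itv.
    - by apply: sub_big_itv; rewrite leq_addr.
  have -> : upper_half = \bigcup_m carleson (big_itv (n + m)) :> set (R * R).
    apply/seteqP; split => z; last by move=> [m _]; exact: carleson_upper_half.
    move=> /carleson_big[m zm]; exists m => //.
    have := @carleson_sub R (big_itv m) (big_itv (n + m)); apply => //.
    - exact: bounded_big_itv.
    - exact: bounded_big_itv.
    - by apply: sub_big_itv; rewrite leq_addl.
  have mQ m : measurable (carleson (big_itv (n + m) : set R)).
    by apply: measurable_carleson; exact: bounded_big_itv.
  have ndQ : nondecreasing_seq (fun m => carleson (big_itv (n + m) : set R)).
    move=> i j ij; apply/subsetPset; apply: carleson_sub.
    - exact: bounded_big_itv.
    - exact: bounded_big_itv.
    - by apply: sub_big_itv; rewrite leq_add2l.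
  have mf m : measurable_fun (carleson (big_itv (n + m)))
      (fun z => (omega z)%:E * (z.2 `^ alpha)%:E).
    exact: (measurable_int_dV (@carleson_upper_half R _) (mQ m) measurable_weightE).
  have f0 m z : carleson (big_itv (n + m)) z ->
      0 <= (omega z)%:E * (z.2 `^ alpha)%:E.
    by move=> /carleson_upper_half Dz; rewrite -EFinM lee_fin mulr_ge0 ?powR_ge0 ?omega_ge0//.
  have cvgw := @ge0_nondecreasing_set_cvg_integral _ _ _ _ _ lam2 ndQ mQ mf f0.
  rewrite /wvolume /int_dV -(cvg_lim _ cvgw)//.
  apply: lim_near_cst => //; apply: nearW => m.
  by apply: wvolume_eq0 => //; exact: bounded_big_itv.
right => I bI; have [n In] := bounded_itv_big bI.
have bn := @bounded_big_itv R n.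
have [v v0 vE] := volume_carleson_gt0 alpha_gtN1 bI.
have S_fin : int_dV alpha (carleson I) sigma < +oo.
  rewrite (le_lt_trans (sigma_infty_sub bI bn In))// ltey.
  by apply/eqP => Sn; apply: no; exists n.
have S_ge0 : 0 <= int_dV alpha (carleson I) sigma by exact: int_dV_ge0.
have := sigma_neq0 bI.
move: S_fin S_ge0; case SE : (int_dV _ _ _) => [S||]// _.
rewrite lee_fin eqe => S_ge0 S_neq0.
have S0 : (0 < S)%R by rewrite lt_neqAle eq_sym S_neq0.
have := wvolume_lower bI bI (@subset_refl _ I) vE v0 S0 SE.
have [B B0 HB] := BB_bound.
have := HB _ bI; rewrite SE vE inver gt_eqF// -EFinM poweR_EFin.
have Sv0 : (0 < (S / v) `^ (r - 1))%R by rewrite powR_gt0// divr_gt0.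
have := wvolume_ge0 I; case: (wvolume _ _ (carleson I)) => [w||]//; last first.
  by move=> _; rewrite gt0_mulye ?gt0_mulye ?lte_fin ?invr_gt0//.
rewrite lee_fin => w_ge0 _; rewrite -EFinM lee_fin => H.
exists w => //; rewrite lt_neqAle w_ge0 andbT; apply/negP => /eqP w_eq0.
by move: H; rewrite -w_eq0 mulr0 leNgt divr_gt0.
Qed.

End weighted_volume.

(** * Suprema over Carleson squares *)

Section density_measure.
Context d (T : measurableType d) (R : realType).
Variables (m : {measure set T -> \bar R}) (D : set T) (h : T -> \bar R).
Hypotheses (mD : measurable D) (mh : measurable_fun D h).
Hypothesis h0 : forall z, D z -> 0 <= h z.

(** The hypotheses are arguments so that the measure structure can be attached to the name;
    extension by 0 outside [D] gives a measure on the whole space. *)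
Definition density (_ : measurable D) (_ : measurable_fun D h)
  (_ : forall z, D z -> 0 <= h z) (A : set T) : \bar R :=
  \int[m]_(z in A) (h \_ D) z.

Local Notation dens := (density mD mh h0).

Let patch_ge0 z : 0 <= (h \_ D) z.
Proof. exact: erestrict_ge0. Qed.

Let density0 : dens set0 = 0.
Proof. by rewrite /density integral_set0. Qed.

Let density_ge0 A : 0 <= dens A.
Proof. by apply: integral_ge0 => z _; exact: patch_ge0. Qed.

Let density_sigma_additive : semi_sigma_additive dens.
Proof.
apply: semi_sigma_additive_nng_induced => //.
exact/(measurable_restrictT h mD).
Qed.

HB.instance Definition _ := isMeasure.Build _ _ _ dens
  density0 density_ge0 density_sigma_additive.

Lemma densityE A : A `<=` D -> dens A = \int[m]_(z in A) h z.
Proof.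
move=> AD; apply: eq_integral => z; rewrite inE => /AD Dz.
by rewrite patchE mem_set.
Qed.

End density_measure.

(* The product Lebesgue measure lives on [measurableTypeR R * measurableTypeR R],
   whose sigma-algebra is that of [R * R] but carries another display. *)
Section plane_measure.
Context {R : realType}.
Variable m : {measure set (measurableTypeR R * measurableTypeR R) -> \bar R}.

Definition plane_measure (A : set (R * R)) : \bar R := m A.

Let plane_measure0 : plane_measure set0 = 0.
Proof. exact: (measure0 m). Qed.

Let plane_measure_ge0 A : 0 <= plane_measure A.
Proof. exact: (measure_ge0 m). Qed.

Let plane_measure_sigma_additive : semi_sigma_additive plane_measure.
Proof. by move=> F mF tF mUF; exact: (@measure_semi_sigma_additive _ _ _ m F mF tF mUF). Qed.

HB.instance Definition _ := isMeasure.Build _ _ _ plane_measure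
  plane_measure0 plane_measure_ge0 plane_measure_sigma_additive.

End plane_measure.

Section sup_carleson.
Context {R : realType}.
Implicit Types (c : set R -> \bar R) (z : R * R).

(** [maximal] and [K_fun] are convertible to instances of this, with the Luxembourg norm and the
    ratio of masses as [c]. *)
Definition sup_carleson c z : \bar R :=
  ereal_sup [set c I | I in [set I | bounded_itv I /\ carleson I z]].

Lemma sup_carleson_ge c I z : bounded_itv I -> carleson I z ->
  c I <= sup_carleson c z.
Proof. by move=> bI Iz; apply: ereal_sup_ubound; exists I. Qed.

Lemma sup_carleson_ge0 c z : (forall I, bounded_itv I -> 0 <= c I) ->
  upper_half z -> 0 <= sup_carleson c z.
Proof.
move=> c0 /carleson_big[n nz].
apply: le_trans (sup_carleson_ge c (bounded_big_itv n) nz).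
exact/c0/bounded_big_itv.
Qed.

Lemma sup_carleson_preimage c (t : \bar R) :
  upper_half `&` [set z | t < sup_carleson c z] =
  \bigcup_(I in [set I | bounded_itv I /\ t < c I]) carleson I.
Proof.
apply/seteqP; split => z.
  move=> [_ /ereal_sup_gt[_ [I [bI Iz] <-] tI]]; exists I => //.
move=> [I [bI tI] Iz]; split; first exact: carleson_upper_half Iz.
exact: (lt_le_trans tI (sup_carleson_ge c bI Iz)).
Qed.

Lemma measurable_sup_carleson c : measurable_fun upper_half (sup_carleson c).
Proof.
move=> mD; apply: (measurability _ (ErealGenOInfty.measurableE R)) => //.
move=> _ [_ [x ->] <-].
rewrite (_ : _ @^-1` _ = [set z | x%:E < sup_carleson c z]).
  rewrite sup_carleson_preimage; apply: measurable_bigcup_carleson.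
  by move=> I [].
by apply/seteqP; split => z /=; rewrite in_itv/= andbT.
Qed.

(** The superlevel set is exactly the union of the squares with t < c I, so it stands on both sides
    of the covering lemma. It yields the weak type of the maximal function, its bound against [mu],
    and the converse bound for the truncated K. *)
Lemma sup_carleson_weak (m1 m2 : {measure set (R * R) -> \bar R}) c
    (a t : R) : (0 <= a)%R ->
  (forall I, bounded_itv I -> t%:E < c I ->
    m1 (carleson (star I)) <= a%:E * m2 (carleson I)) ->
  m1 (superlevel upper_half (sup_carleson c) t) <=
  a%:E * m2 (superlevel upper_half (sup_carleson c) t).
Proof.
move=> a0 H; rewrite /superlevel sup_carleson_preimage.
by apply: covering => // [I []|I [bI tI]]//; exact: H.
Qed.

End sup_carleson.

(** * Young functions *)

Section young_functions.
Context {R : realType}.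
Variable Phi : R -> R.
Hypothesis young_Phi : young Phi.

Lemma young_ge0 (t : R) : (0 <= t)%R -> (0 <= Phi t)%R.
Proof. by case: young_Phi => + _ _ _ _; apply. Qed.

Lemma young_le (s t : R) : (0 <= s)%R -> (s <= t)%R -> (Phi s <= Phi t)%R.
Proof.
case: young_Phi => _ _ _ ndPhi _ s0 st; apply: ndPhi => //.
  by rewrite in_itv/= s0.
by rewrite in_itv/= (le_trans s0).
Qed.

(** Convexity between 0 and t, with Phi 0 = 0. *)
Let young_scale (l t : R) : (0 <= l <= 1)%R -> (0 <= t)%R ->
  (Phi (l * t) <= l * Phi t)%R.
Proof.
move=> l01 t0; case: young_Phi => _ _ cvx _ [Phi0 _ _].
have tin : (t : R^o) \in (`[0%R, +oo[%classic : set R^o).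
  by rewrite inE/= in_itv/= t0.
have zin : (0%R : R^o) \in (`[0%R, +oo[%classic : set R^o).
  by rewrite inE/= in_itv/= lexx.
have l0 : (0 <= l)%R by case/andP: l01.
have l1 : (l <= 1)%R by case/andP: l01.
have := cvx (Itv01 l0 l1) t 0%R tin zin.
have E : conv (Itv01 l0 l1) (t : R^o) (0%R : R^o) = (l * t)%R.
  by rewrite convRE/= mulr0 addr0.
by rewrite [X in (_ <= X)%R]convRE /= Phi0 mulr0 addr0 -E => h; exact: h.
Qed.

Lemma young_ge_id (t : R) : (1 <= t)%R -> (t <= Phi t)%R.
Proof.
move=> t1; have t0 : (0 < t)%R by rewrite (lt_le_trans ltr01).
case: (young_Phi) => _ _ _ _ [_ _ Phi1].
have := @young_scale t^-1 t; rewrite mulVf ?gt_eqF// Phi1 invr_ge0 (ltW t0).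
rewrite invf_le1// t1 => /(_ isT isT).
by rewrite mulrC ler_pdivlMr// mul1r.
Qed.

Lemma young_half : (Phi 2^-1 <= 2^-1)%R.
Proof.
case: (young_Phi) => _ _ _ _ [_ _ Phi1].
have := @young_scale 2^-1 1; rewrite !mulr1 Phi1 mulr1; apply => //.
by apply/andP; split; lra.
Qed.

Lemma measurable_young d (T : measurableType d) (D : set T) (g : T -> R) :
  measurable_fun D g -> (forall z, (0 <= g z)%R) ->
  measurable_fun D (Phi \o g).
Proof.
move=> mg g0.
(* [Phi] is constrained on [0, +oo[ only; clipping the argument at 0 makes it monotone on the whole
   line without changing the composite. *)
pose P (x : R) := Phi (Num.max 0%R x).
have -> : Phi \o g = P \o g.
  by apply/funext => z; rewrite /P/= max_r.
apply: measurableT_comp => //; apply: nondecreasing_measurable => //.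
move=> x y xy; apply: young_le; first by rewrite le_max lexx.
by rewrite ge_max le_max lexx/= le_max xy orbT.
Qed.

(** * The growth condition B_p in dyadic form *)

Section growth_series.
Variable p : R.
Hypothesis p_gt1 : (1 < p)%R.

(** Up to a constant, a lower bound for the integral of Phi(t) / t^p dt / t over [2^j, 2^(j+1)[. *)
Definition young_coef (j : nat) : R := (Phi (2 ^+ j) / (2 ^+ j) `^ p)%R.

Lemma young_coef_ge0 j : (0 <= young_coef j)%R.
Proof. by rewrite divr_ge0 ?powR_ge0// young_ge0// exprn_ge0. Qed.

Let measurable_integrand (c : R) : (0 < c)%R ->
  measurable_fun `[c, +oo[%classic (fun t => (Phi t / t `^ p / t)%:E).
Proof.
move=> c0; apply/measurable_EFinP.
pose P (t : R) := Phi (Num.max 0%R t).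
apply: (eq_measurable_fun (fun t => P t * (t `^ (- p)) * t `^ (- 1))%R).
  move=> t; rewrite inE/= in_itv/= andbT => ct.
  have t0 : (0 < t)%R by exact: lt_le_trans ct.
  by rewrite /P max_r ?(ltW t0)// powRN powR_inv1// ltW.
apply: measurable_funM; last by apply: measurable_funTS; exact: measurable_powR.
apply: measurable_funM; last by apply: measurable_funTS; exact: measurable_powR.
apply: measurable_funTS; apply: nondecreasing_measurable => //.
move=> x y xy; apply: young_le; first by rewrite le_max lexx.
by rewrite ge_max le_max lexx/= le_max xy orbT.
Qed.

Lemma young_coef_summable (c : R) : (0 < c)%R ->
  \int[lebesgue_measure]_(t in `[c, +oo[) (Phi t / t `^ p / t)%:E < +oo ->
  exists2 S : R, (0 < S)%R &
    forall N, (\sum_(0 <= j < N) young_coef j <= S)%R.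
Proof.
move=> c0 int_fin; set F := (fun t : R => (Phi t / t `^ p / t)%:E) in int_fin.
have [j0 cj0] : exists j, (c < 2 ^+ j)%R.
  have [j cj] := level_unbounded c (@ltr01 R); exists j.
  by move: cj; rewrite /level mul1r.
pose B (i : nat) : set R := `[(2 ^+ (j0 + i))%R, (2 ^+ (j0 + i.+1))%R[%classic.
have pow_gt0 (n : nat) : (0 < 2 ^+ n :> R)%R by rewrite exprn_gt0.
have F_ge0 t : `[c, +oo[%classic t -> 0 <= F t.
  rewrite /= in_itv/= andbT => ct; have t0 : (0 < t)%R by exact: lt_le_trans ct.
  by rewrite lee_fin !divr_ge0 ?powR_ge0 ?young_ge0 ?ltW.
have Bsub i : B i `<=` `[c, +oo[%classic.
  move=> t; rewrite /B/= !in_itv/= andbT => /andP[h _].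
  apply: le_trans h; apply: (le_trans (ltW cj0)).
  by rewrite ler_eXn2l ?ltr1n// leq_addr.
have mB i : measurable (B i) by exact: measurable_itv.
have mF := measurable_integrand c0.
have tB : trivIset setT B.
  move=> i k _ _ [t]; rewrite /B/= !in_itv/= => -[/andP[i1 i2] /andP[k1 k2]].
  apply/eqP; rewrite eqn_leq; apply/andP; split.
    have := le_lt_trans i1 k2; rewrite ltr_eXn2l ?ltr1n//.
    by rewrite ltn_add2l ltnS.
  have := le_lt_trans k1 i2; rewrite ltr_eXn2l ?ltr1n//.
  by rewrite ltn_add2l ltnS.
pose k : R := (2 * 2 `^ p)%R.
have k0 : (0 < k)%R by rewrite mulr_gt0// powR_gt0.
(* On [x, 2x[ with x = 2^(j0 + i), the numerator is at least Phi x and the denominators are at most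
   their values at 2x. The length x of the block then produces k = 2 * 2^p. *)
have block i : (young_coef (j0 + i) / k)%:E <=
    \int[lebesgue_measure]_(t in B i) F t.
  set x : R := (2 ^+ (j0 + i))%R.
  have x0 : (0 < x)%R by exact: pow_gt0.
  have x2 : (2 ^+ (j0 + i.+1) = 2 * x)%R by rewrite addnS exprS.
  have -> : (young_coef (j0 + i) / k)%:E =
      \int[lebesgue_measure]_(t in B i) (Phi x / (2 * x) `^ p / (2 * x))%:E.
    have lB : lebesgue_measure (B i) = x%:E.
      rewrite lebesgue_measure_itv/= lte_fin x2 -/x ltr_pMl// ltr1n -EFinB.
      by congr EFin; ring.
    rewrite integral_cst; last exact: mB.
    transitivity ((Phi x / (2 * x) `^ p / (2 * x))%:E * x%:E).
      rewrite -EFinM; congr EFin.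
      rewrite /young_coef -/x /k powRM ?(ltW x0)//; field.
      by rewrite !gt_eqF ?powR_gt0.
    by rewrite -lB.
  apply: ge0_le_integral => //; first exact: mB.
  - move=> t _; rewrite lee_fin !divr_ge0 ?powR_ge0 ?young_ge0 ?(ltW x0)//.
    by rewrite mulr_ge0// ltW.
  - exact: measurable_funS (Bsub i) mF.
  - move=> t; rewrite /B/= in_itv/= x2 -/x => /andP[xt tx].
    have t0 : (0 < t)%R by exact: lt_le_trans xt.
    rewrite lee_fin; apply: ler_pM.
    + by rewrite divr_ge0 ?powR_ge0 ?young_ge0 ?(ltW x0).
    + by rewrite invr_ge0 mulr_ge0// ltW.
    + apply: ler_pM.
      * by rewrite young_ge0// ltW.
      * by rewrite invr_ge0 powR_ge0.
      * by apply: young_le => //; exact: ltW.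
      * rewrite lef_pV2 ?posrE ?powR_gt0 ?mulr_gt0//; apply: ge0_ler_powR.
        - by rewrite (le_trans ler01)// ltW.
        - by rewrite nnegrE ltW.
        - by rewrite nnegrE mulr_ge0// ltW.
        - exact: ltW.
    + by rewrite lef_pV2 ?posrE ?mulr_gt0// ltW.
have tot : \sum_(i <oo) \int[lebesgue_measure]_(t in B i) F t <=
    \int[lebesgue_measure]_(t in `[c, +oo[) F t.
  rewrite -ge0_integral_bigcup//.
  - apply: ge0_subset_integral => //.
    + by apply: bigcup_measurable => i _; exact: mB.
    + by move=> t [i _ /Bsub].
  - apply: measurable_funS mF => // t [i _]; exact: Bsub.
  - by move=> t [i _ /Bsub/F_ge0].
have tail_ge0 i : 0 <= \int[lebesgue_measure]_(t in B i) F t.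
  by apply: integral_ge0 => t /Bsub/F_ge0.
have tot_ge0 : 0 <= \int[lebesgue_measure]_(t in `[c, +oo[) F t.
  by apply: integral_ge0.
move: int_fin tot_ge0 tot; case: (\int[lebesgue_measure]_(t in `[c, +oo[) F t) => [M||]//.
move=> _; rewrite lee_fin => M0 tot.
pose S0 : R := (\sum_(0 <= j < j0) young_coef j)%R.
have S00 : (0 <= S0)%R by apply: sumr_ge0 => j _; exact: young_coef_ge0.
(* Indices below [j0], where 2^j may lie below [c], enter through the finite sum [S0]. *)
exists (S0 + M * k + 1)%R; first by rewrite ltr_wpDl// addr_ge0// mulr_ge0// ltW.
move=> N; apply: (@le_trans _ _ (\sum_(0 <= j < j0 + N) young_coef j)%R).
  rewrite [leRHS](@big_cat_nat _ _ _ N)//=; last by rewrite leq_addl.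
  by rewrite lerDl sumr_ge0// => j _; exact: young_coef_ge0.
rewrite (@big_cat_nat _ _ _ j0)//= ?leq_addr//.
rewrite -addrA lerD2l (le_trans _ (ler_wpDr ler01 (lexx _)))//.
rewrite -{1}(add0n j0) big_addn addKn -ler_pdivrMr// mulr_suml.
rewrite -lee_fin -sumEFin; apply: le_trans tot.
apply: (@le_trans _ _ (\sum_(0 <= i < N) \int[lebesgue_measure]_(t in B i) F t)).
  by apply: lee_sum => i _; rewrite addnC; exact: block.
exact: nneseries_lim_ge.
Qed.

(** The contribution of a value x = |f(z)| at the level t = [level t0 n], once the weak-type bound
    is multiplied by t^p. *)
Definition young_term (t0 x : R) (n : nat) : R :=
  if (level t0 n < 2 * x)%R then (level t0 n `^ p * Phi (x / level t0 n))%R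
  else 0%R.

Lemma young_term_ge0 t0 x n : (0 < t0)%R -> (0 <= x)%R ->
  (0 <= young_term t0 x n)%R.
Proof.
move=> t00 x0; rewrite /young_term; case: ifPn => // _.
by rewrite mulr_ge0 ?powR_ge0 ?young_ge0// divr_ge0// ltW// level_gt0.
Qed.

(* With [m] the last index such that [level t0 m < 2 * x], one has
   [x / level t0 n <= 2 ^+ (m - n)] for [n <= m]. *)
Lemma young_series_le (S : R) : (0 < S)%R ->
  (forall N, (\sum_(0 <= j < N) young_coef j <= S)%R) ->
  forall (t0 x : R) N, (0 < t0)%R -> (0 <= x)%R ->
  (\sum_(0 <= n < N) young_term t0 x n <= 2 `^ p * S * x `^ p)%R.
Proof.
move=> S0 HS t0 x N t00 x0.
have [t0x|t0x] := ltP t0 (2 * x)%R; last first.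
  rewrite big1 ?mulr_ge0 ?powR_ge0 ?(ltW S0)// => n _.
  rewrite /young_term ltNge ifF//; apply/negbF; apply: (le_trans t0x).
  by rewrite -[leLHS]mulr1 ler_pM2l// exprn_ege1// ler1n.
have [m /andP[mx xm]] := level_cover t00 t0x.
have lm0 := level_gt0 m t00.
apply: (@le_trans _ _ (\sum_(0 <= n < m.+1) young_term t0 x n)%R).
  apply: (@le_trans _ _ (\sum_(0 <= n < m.+1 + N) young_term t0 x n)%R).
    rewrite [leRHS](@big_cat_nat _ _ _ N)//=; last by rewrite leq_addl.
    by rewrite lerDl sumr_ge0// => n _; exact: young_term_ge0.
  rewrite (@big_cat_nat _ _ _ m.+1)//= ?leq_addr// gerDl.
  rewrite big_nat_cond big1// => n /andP[/andP[mn _] _].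
  rewrite /young_term ltNge ifF//; apply/negbF; apply: (le_trans xm).
  exact: le_level.
have bnd n : (n < m.+1)%N ->
    (young_term t0 x n <= level t0 m `^ p * young_coef (m - n))%R.
  rewrite ltnS => nm; have ln0 := level_gt0 n t00.
  have lmn : level t0 m = (level t0 n * 2 ^+ (m - n))%R.
    by rewrite /level -mulrA -exprD subnKC.
  rewrite /young_term (le_lt_trans (le_level t00 nm))//.
  rewrite lmn powRM ?exprn_ge0 ?(ltW ln0)// /young_coef.
  have E2 : (0 < (2 ^+ (m - n)) `^ p :> R)%R by rewrite powR_gt0// exprn_gt0.
  rewrite -mulrA ler_pM2l ?powR_gt0// [leRHS]mulrC divfK ?gt_eqF//.
  apply: young_le; first by rewrite divr_ge0// ltW.
  rewrite ler_pdivrMr// mulrC -lmn.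
  by rewrite levelS ler_pM2l in xm.
apply: (@le_trans _ _ (\sum_(0 <= n < m.+1)
    level t0 m `^ p * young_coef (m - n))%R).
  by rewrite big_nat_cond [leRHS]big_nat_cond; apply: ler_sum => n /andP[/bnd].
rewrite -mulr_sumr.
have -> : (\sum_(0 <= n < m.+1) young_coef (m - n) =
    \sum_(0 <= n < m.+1) young_coef n)%R.
  rewrite big_nat_rev/= !big_mkord; apply: eq_bigr => i _.
  by rewrite add0n subSS subKn// -ltnS.
rewrite mulrAC; apply: ler_pM => //.
- exact: powR_ge0.
- by apply: sumr_ge0 => j _; exact: young_coef_ge0.
rewrite -powRM//; apply: ge0_ler_powR.
- by rewrite (le_trans ler01)// ltW.
- by rewrite nnegrE ltW.
- by rewrite nnegrE mulr_ge0.
- exact: ltW.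
Qed.

End growth_series.

End young_functions.

(** * The maximal function on the weighted Lp space *)

Section maximal_strong_type.
Context {R : realType}.
Variables (alpha p : R) (Phi : R -> R) (omega : R * R -> R).
Hypothesis weight_omega : weight omega.
Hypothesis young_Phi : young Phi.
Implicit Types (f : R * R -> R[i]) (I : set R).

Local Notation lam2 := (@lebesgue_measure R \x @lebesgue_measure R)%E.

Definition weight_density (z : R * R) : \bar R :=
  (omega z)%:E * (z.2 `^ alpha)%:E.

Lemma weight_density_ge0 z : upper_half z -> 0 <= weight_density z.
Proof.
move=> Dz; rewrite /weight_density -EFinM lee_fin mulr_ge0 ?powR_ge0//.
by case: weight_omega => _ + _; apply.
Qed.

Lemma measurable_weight_density : measurable_fun upper_half weight_density.
Proof.
apply: (measurable_int_dV _ (@subset_refl _ _)).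
  exact: measurable_upper_half.
exact: measurable_weightE.
Qed.

Lemma int_dV_weight E (g : R * R -> R) : int_dV alpha E (fun z => (g z * omega z)%:E) =
  \int[lam2]_(z in E) ((g z)%:E * weight_density z).
Proof. by apply: eq_integral => z _; rewrite /weight_density EFinM muleA. Qed.

Lemma cmod_ge0 f z : (0 <= cmod f z)%R.
Proof. by rewrite /cmod; case: (f z) => a b; exact: sqrtr_ge0. Qed.

Lemma luxembourg_ge0 f I : 0 <= luxembourg Phi omega alpha f I.
Proof.
apply: le_ereal_inf_tmp => _ [l [l0 _] <-].
by rewrite lee_fin ltW.
Qed.

(** Values x <= t / 2 are discarded: they add at most Phi(1/2) <= 1/2 to an average of Phi(x / t).
    Without this cut the sum of t^p Phi(x / t) over large levels t need not converge. *)
Definition truncated_young (t x : R) : R :=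
  if (t < 2 * x)%R then Phi (x / t) else 0%R.

Lemma truncated_young_ge0 t x : (0 < t)%R -> (0 <= x)%R ->
  (0 <= truncated_young t x)%R.
Proof.
move=> t0 x0; rewrite /truncated_young; case: ifPn => // _.
by apply: (young_ge0 young_Phi); rewrite divr_ge0// ltW.
Qed.

Lemma young_le_truncated t x : (0 < t)%R -> (0 <= x)%R ->
  (Phi (x / t) <= truncated_young t x + 2^-1)%R.
Proof.
move=> t0 x0; rewrite /truncated_young; case: ifPn => [_|].
  by rewrite lerDl invr_ge0.
rewrite -leNgt => xt; rewrite add0r (le_trans _ (young_half young_Phi))//.
apply: (young_le young_Phi); first by rewrite divr_ge0// ltW.
by rewrite ler_pdivrMr//; lra.
Qed.

Let measurable_mf f t : measurable_fun upper_half (cmod f) ->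
  (0 < t)%R -> measurable_fun upper_half (fun z => Phi (cmod f z / t)).
Proof.
move=> mf t0; apply: (measurable_young young_Phi).
  apply: measurable_funM => //; exact: measurable_cst.
by move=> z; rewrite divr_ge0 ?cmod_ge0// ltW.
Qed.

Lemma measurable_truncated_young f t : measurable_fun upper_half (cmod f) ->
  (0 < t)%R -> measurable_fun upper_half (fun z => truncated_young t (cmod f z)).
Proof.
move=> mf t0; rewrite /truncated_young.
have mD := @measurable_upper_half R.
apply: (measurable_fun_if mD) => //.
  apply: measurable_fun_ltr; first exact: measurable_cst.
  by apply: measurable_funM => //; exact: measurable_cst.
apply: measurable_funS (measurable_mf mf t0) => //; exact: subIsetl.
Qed.

Hypothesis wvolume_fin : forall I, bounded_itv I -> exists2 w : R, (0 < w)%R &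
  wvolume omega alpha (carleson I) = w%:E.

Let mwD (E : set (R * R)) (g : R * R -> R) : E `<=` upper_half -> measurable E ->
  measurable_fun upper_half g ->
  measurable_fun E (fun z => (g z)%:E * weight_density z).
Proof.
move=> ED mE mg; apply: (measurable_funS (@measurable_upper_half R) ED).
apply: emeasurable_funM; last exact: measurable_weight_density.
exact/measurable_EFinP.
Qed.

(** As t is not admissible in the infimum, the average of Phi(|f| / t) exceeds 1. The discarded
    values account for at most 1/2 of it, which leaves more than 1/2 for [truncated_young]. *)
Lemma luxembourg_gt f I t : measurable_fun upper_half (cmod f) ->
  bounded_itv I -> (0 < t)%R -> t%:E < luxembourg Phi omega alpha f I ->
  wvolume omega alpha (carleson I) <= 2%:E *
   \int[lam2]_(z in carleson I) ((truncated_young t (cmod f z))%:E * weight_density z).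
Proof.
move=> mf bI t0 tlux; have [w w0 wE] := wvolume_fin bI.
have mI := measurable_carleson bI; have ID := @carleson_upper_half R I.
have : ~~ (int_dV alpha (carleson I) (fun z => (Phi (cmod f z / t) * omega z)%:E)
    / wvolume omega alpha (carleson I) <= 1).
  apply/negP => H; move: tlux; rewrite ltNge => /negP; apply.
  by apply: ereal_inf_lbound; exists t.
rewrite -ltNge wE inver gt_eqF// lte_pdivlMr// mul1e int_dV_weight => wlt.
set X := \int[lam2]_(z in carleson I) _.
have tr0 z : (0 <= truncated_young t (cmod f z))%R.
  by rewrite truncated_young_ge0// cmod_ge0.
have : \int[lam2]_(z in carleson I) ((Phi (cmod f z / t))%:E * weight_density z) <=
    X + (2^-1)%:E * w%:E.
  rewrite -wE /wvolume /int_dV -[X in _ * X]/(\int[lam2]_(z in carleson I) weight_density z).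
  rewrite -ge0_integralZl//; last 2 first.
  - apply: (measurable_funS (@measurable_upper_half R) ID).
    exact: measurable_weight_density.
  - by move=> z /ID Dz; exact: weight_density_ge0.
  rewrite -ge0_integralD//; last 4 first.
  - by move=> z /ID Dz; rewrite mule_ge0 ?weight_density_ge0// lee_fin.
  - by apply: mwD => //; exact: measurable_truncated_young.
  - by move=> z /ID Dz; rewrite mule_ge0 ?weight_density_ge0.
  - by apply: (@mwD _ (cst 2^-1%R)) => //; exact: measurable_cst.
  apply: ge0_le_integral => //.
  - move=> z /ID Dz; rewrite mule_ge0 ?weight_density_ge0// lee_fin.
    by rewrite (young_ge0 young_Phi)// divr_ge0 ?cmod_ge0// ltW.
  - by apply: mwD => //; exact: measurable_mf.
  - apply: emeasurable_funD.
      by apply: mwD => //; exact: measurable_truncated_young.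
    by apply: (@mwD _ (cst 2^-1%R)) => //; exact: measurable_cst.
  - move=> z /ID Dz.
    apply: (@le_trans _ _ ((truncated_young t (cmod f z) + 2^-1)%:E * weight_density z)).
      apply: lee_wpmul2r; first exact: weight_density_ge0.
      by rewrite lee_fin young_le_truncated// cmod_ge0.
    by rewrite EFinD ge0_muleDl// lee_fin.
have X0 : 0 <= X.
  by apply: integral_ge0 => z /ID Dz; rewrite mule_ge0 ?weight_density_ge0// lee_fin.
move=> /(lt_le_trans wlt); move: X0; case: X => [x||]//; last first.
  by move=> _ _; rewrite gt0_muley ?leey// lte_fin.
by rewrite -!EFinM -EFinD !lee_fin lte_fin => x0 ?; lra.
Qed.

(** For l < a one has Phi(|f| / l) >= |f| / l >= a / l > 1 on the whole square, so l is not
    admissible. *)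
Lemma luxembourg_ge f I (a : R) : measurable_fun upper_half (cmod f) ->
  bounded_itv I -> (0 < a)%R -> (forall z, carleson I z -> (a <= cmod f z)%R) ->
  a%:E <= luxembourg Phi omega alpha f I.
Proof.
move=> mf bI a0 fa; have [w w0 wE] := wvolume_fin bI.
have mI := measurable_carleson bI; have ID := @carleson_upper_half R I.
apply: le_ereal_inf_tmp => _ [l [l0 H] <-]; rewrite lee_fin leNgt; apply/negP => la.
move: H; rewrite leNgt => /negP; apply.
rewrite wE inver gt_eqF// lte_pdivlMr// mul1e int_dV_weight.
have al1 : (1 < a / l)%R by rewrite ltr_pdivlMr// mul1r.
apply: (@lt_le_trans _ _ ((a / l)%:E * w%:E)).
  by rewrite -EFinM lte_fin ltr_pMl.
rewrite -wE /wvolume /int_dV -[X in _ * X]/(\int[lam2]_(z in carleson I) weight_density z).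
rewrite -ge0_integralZl//; last 3 first.
- apply: (measurable_funS (@measurable_upper_half R) ID).
  exact: measurable_weight_density.
- by move=> z /ID Dz; exact: weight_density_ge0.
- by rewrite lee_fin (le_trans ler01)// ltW.
apply: ge0_le_integral => //.
- move=> z /ID Dz; rewrite mule_ge0 ?weight_density_ge0// lee_fin.
  by rewrite (le_trans ler01)// ltW.
- by apply: (@mwD _ (cst (a / l)%R)) => //; exact: measurable_cst.
- by apply: mwD => //; exact: measurable_mf.
- move=> z Iz; apply: lee_wpmul2r; first by apply: weight_density_ge0; exact: ID.
  have fal : (a / l <= cmod f z / l)%R by rewrite ler_pM2r ?invr_gt0// fa.
  rewrite lee_fin (le_trans fal)// (young_ge_id young_Phi)//.
  by rewrite (le_trans _ fal)// ltW.
Qed.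

Variable Cd : R.
Hypothesis Cd_gt0 : (0 < Cd)%R.
Hypothesis doubling : forall I, bounded_itv I ->
  wvolume omega alpha (carleson (star I)) <= Cd%:E * wvolume omega alpha (carleson I).

Let mD := @measurable_upper_half R.

Lemma maximal_weak f t : measurable_fun upper_half (cmod f) -> (0 < t)%R ->
  \int[lam2]_(z in superlevel upper_half (maximal Phi omega alpha f) t) weight_density z <=
  (Cd * 2)%:E * \int[lam2]_(z in upper_half)
    ((truncated_young t (cmod f z))%:E * weight_density z).
Proof.
move=> mf t0.
have m1 := measurable_weight_density; have h1 := weight_density_ge0.
have m2 := mwD (@subset_refl _ _) mD (measurable_truncated_young mf t0).
have h2 z : upper_half z ->
    0 <= (truncated_young t (cmod f z))%:E * weight_density z.
  move=> Dz; rewrite mule_ge0 ?weight_density_ge0// lee_fin.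
  by rewrite truncated_young_ge0// cmod_ge0.
have := @sup_carleson_weak R (plane_measure (density lam2 mD m1 h1))
  (plane_measure (density lam2 mD m2 h2))
  (luxembourg Phi omega alpha f) (Cd * 2) t.
rewrite -/(maximal Phi omega alpha f).
set E := superlevel _ _ _; have ED : E `<=` upper_half by exact: subIsetl.
have mE : measurable E.
  by apply: measurable_superlevel => //; exact: measurable_sup_carleson.
rewrite /plane_measure/= !densityE// => weak.
apply: (@le_trans _ _ ((Cd * 2)%:E *
    \int[lam2]_(z in E) ((truncated_young t (cmod f z))%:E * weight_density z))).
  apply: weak; first by rewrite mulr_ge0// ltW.
  move=> I bI tI; rewrite /plane_measure/= !densityE; [|exact: carleson_upper_half..].
  apply: (le_trans (doubling bI)); rewrite EFinM -muleA.
  apply: lee_wpmul2l; first by rewrite lee_fin ltW.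
  exact: luxembourg_gt.
apply: lee_wpmul2l; first by rewrite lee_fin mulr_ge0// ltW.
exact: ge0_subset_integral.
Qed.

Hypothesis p_gt1 : (1 < p)%R.
Hypothesis class_B_Phi : class_B p Phi.

(** A Marcinkiewicz-type argument: the weak bound at level t sees only |f| > t / 2; multiplied by
    t^p and summed over the levels, it is estimated pointwise by [young_series_le]. *)
Lemma maximal_strong : exists2 C : R, (0 < C)%R & forall f,
  measurable_fun upper_half (cmod f) ->
  \int[lam2]_(z in upper_half) (maximal Phi omega alpha f z `^ p * weight_density z) <=
  C%:E * \int[lam2]_(z in upper_half) ((cmod f z `^ p)%:E * weight_density z).
Proof.
have p_gt0 : (0 < p)%R by exact: lt_trans p_gt1.
have [_ _ [c c0 int_fin]] := class_B_Phi.
have [S S0 HS] := young_coef_summable young_Phi p_gt1 c0 int_fin.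
pose C0 : R := (2 `^ p * S)%R.
have C00 : (0 < C0)%R by rewrite mulr_gt0// powR_gt0.
exists (2 `^ p * (Cd * 2 * C0))%R; first by rewrite !mulr_gt0// powR_gt0.
move=> f mf; set F := \int[lam2]_(z in _) ((cmod f z `^ p)%:E * _).
have m1 := measurable_weight_density; have h1 := weight_density_ge0.
have ytr0 t0 n z : (0 < t0)%R -> (0 <= truncated_young (level t0 n) (cmod f z))%R.
  by move=> t00; rewrite truncated_young_ge0 ?level_gt0// cmod_ge0.
apply: level_integral_le => //.
- exact: measurable_sup_carleson.
- move=> z Dz; apply: sup_carleson_ge0 => // I _; exact: luxembourg_ge0.
move=> t0 t00; rewrite [(2 `^ p * (_ * _))%:E]EFinM -muleA.
apply: lee_wpmul2l; first by rewrite lee_fin powR_ge0.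
rewrite [(Cd * 2 * C0)%:E]EFinM -muleA.
pose Y n := \int[lam2]_(z in upper_half)
  ((young_term Phi p t0 (cmod f z) n)%:E * weight_density z).
have YE n : (level t0 n `^ p)%:E * \int[lam2]_(z in upper_half)
    ((truncated_young (level t0 n) (cmod f z))%:E * weight_density z) = Y n.
  have ln0 := level_gt0 n t00.
  rewrite -ge0_integralZl//; last 3 first.
  - by apply: mwD => //; exact: measurable_truncated_young.
  - by move=> z Dz; rewrite mule_ge0 ?h1// lee_fin ytr0.
  - by rewrite lee_fin powR_ge0.
  apply: eq_integral => z _; rewrite muleA; congr (_ * _); rewrite -EFinM; congr EFin.
  by rewrite /young_term /truncated_young; case: ifPn => //; rewrite mulr0.
have yt0 n z : (0 <= young_term Phi p t0 (cmod f z) n)%R.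
  by rewrite young_term_ge0// cmod_ge0.
have myt n : measurable_fun upper_half (fun z => young_term Phi p t0 (cmod f z) n).
  apply: (eq_measurable_fun (fun z =>
      level t0 n `^ p * truncated_young (level t0 n) (cmod f z))%R).
    by move=> z _; rewrite /young_term /truncated_young; case: ifPn => //; rewrite mulr0.
  apply: measurable_funM; first exact: measurable_cst.
  by apply: measurable_truncated_young => //; exact: level_gt0.
apply: (@le_trans _ _ (\sum_(n <oo) (Cd * 2)%:E * Y n)).
  apply: lee_nneseries => [n _ _|n _].
    rewrite mule_ge0 ?lee_fin ?powR_ge0//; apply: integral_ge0 => z [Dz _].
    exact: h1.
  rewrite -YE muleCA; apply: lee_wpmul2l; first by rewrite lee_fin powR_ge0.
  by apply: maximal_weak => //; exact: level_gt0.
rewrite nneseriesZl; last first.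
  by move=> n _; apply: integral_ge0 => z Dz; rewrite mule_ge0 ?h1// lee_fin.
apply: lee_wpmul2l; first by rewrite lee_fin mulr_ge0// ltW.
rewrite /Y -integral_nneseries//; last 2 first.
- by move=> n; exact: mwD.
- by move=> n z Dz; rewrite mule_ge0 ?h1// lee_fin.
have mFp : measurable_fun upper_half (fun z => (cmod f z `^ p)%R).
  exact: (measurableT_comp (measurable_powR p)).
rewrite /F -ge0_integralZl//; last 3 first.
- exact: mwD.
- by move=> z Dz; rewrite mule_ge0 ?h1// lee_fin powR_ge0.
- by rewrite lee_fin ltW.
apply: ge0_le_integral => //.
- move=> z Dz; apply: nneseries_ge0 => n _ _.
  by rewrite mule_ge0 ?h1// lee_fin.
- apply: ge0_emeasurable_sum => [n z Dz _|n _].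
    by rewrite mule_ge0 ?h1// lee_fin.
  exact: mwD.
- apply: measurable_funeM; exact: mwD.
move=> z Dz; rewrite nneseriesZr_ge0; last 2 first.
- by move=> n; rewrite lee_fin.
- exact: h1.
rewrite [leRHS]muleA; apply: lee_wpmul2r; first exact: h1.
apply: lime_le; first by apply: is_cvg_nneseries => n _ _; rewrite lee_fin.
apply: nearW => N; rewrite sumEFin -EFinM lee_fin.
apply: young_series_le => //; exact: cmod_ge0.
Qed.

End maximal_strong_type.

(** * Sufficiency *)

Section weighted_young.
Context {R : realType}.
Variables (p q : R).
Hypotheses (q_gt0 : (0 < q)%R) (qp : (q < p)%R).

Let pq_gt0 : (0 < p - q)%R. Proof. by rewrite subr_gt0. Qed.

(* Either [k <= e * x ^ (p - q)] or [x ^ q <= (k / e) ^ (q / (p - q))]. *)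
Lemma weighted_young (e x k : R) : (0 < e)%R -> (0 <= x)%R -> (0 <= k)%R ->
  (x `^ q * k <= e * x `^ p + e `^ (- (q / (p - q))) * k `^ (p / (p - q)))%R.
Proof.
move=> e0 x0 k0; have [kx|xk] := leP k (e * x `^ (p - q))%R.
  apply: (@le_trans _ _ (e * x `^ p)%R); last first.
    by rewrite lerDl mulr_ge0 ?powR_ge0.
  apply: (le_trans (ler_wpM2l (powR_ge0 _ _) kx)).
  rewrite mulrCA -powRD.
    by rewrite addrC subrK.
  by rewrite addrC subrK gt_eqF// (lt_trans q_gt0).
have k_gt0 : (0 < k)%R by rewrite (le_lt_trans _ xk)// mulr_ge0 ?powR_ge0// ltW.
apply: (@le_trans _ _ (e `^ (- (q / (p - q))) * k `^ (p / (p - q)))%R); last first.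
  by rewrite lerDr mulr_ge0 ?powR_ge0// ltW.
have xle : (x `^ q <= (k / e) `^ (q / (p - q)))%R.
  have -> : (x `^ q = (x `^ (p - q)) `^ (q / (p - q)))%R.
    by rewrite -powRrM; congr powR; field; rewrite gt_eqF.
  apply: ge0_ler_powR.
  - by rewrite divr_ge0// ltW.
  - by rewrite nnegrE powR_ge0.
  - by rewrite nnegrE divr_ge0// ltW.
  - by rewrite ler_pdivlMr// mulrC ltW.
apply: (le_trans (ler_wpM2r k0 xle)).
have -> : (p / (p - q) = q / (p - q) + 1)%R by field; rewrite gt_eqF.
rewrite [in leRHS]powRD; last by rewrite (gt_eqF k_gt0) implybT.
have eN : (e^-1 `^ (q / (p - q)) = e `^ (- (q / (p - q))))%R.
  by rewrite -[e^-1%R]powR_inv1 ?(ltW e0)// -powRrM mulN1r.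
rewrite powRr1// powRM ?invr_ge0 ?(ltW e0)// eN.
by rewrite le_eqVlt; apply/orP; left; apply/eqP; ring.
Qed.

Lemma weighted_younge (e : R) (x k : \bar R) : (0 < e)%R -> 0 <= x -> 0 <= k ->
  x `^ q * k <= e%:E * x `^ p + (e `^ (- (q / (p - q))))%:E * k `^ (p / (p - q)).
Proof.
have p_gt0 : (0 < p)%R by exact: lt_trans qp.
have s0 : (0 < p / (p - q))%R by rewrite divr_gt0.
move=> e0; case: k => [k||]// x0 k0; last first.
  have h : 0 <= e%:E * x `^ p.
    by rewrite mule_ge0 ?poweR_ge0//; rewrite lee_fin ltW.
  rewrite [in leRHS]poweRyr ?gt_eqF// [in leRHS]gt0_muley ?lte_fin ?powR_gt0//.
  by rewrite addey ?leey// -ltNye (lt_le_trans ltNy0 h).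
move: x0; case: x => [x||]// x0; last first.
  have h : 0 <= (e `^ (- (q / (p - q))))%:E * k%:E `^ (p / (p - q)).
    by rewrite mule_ge0 ?poweR_ge0//; rewrite lee_fin powR_ge0.
  rewrite [in leRHS]poweRyr ?gt_eqF// [in leRHS]gt0_muley ?lte_fin//.
  by rewrite addye ?leey// -ltNye (lt_le_trans ltNy0 h).
by rewrite !poweR_EFin -!EFinM -EFinD lee_fin; apply: weighted_young.
Qed.

(* Optimizing [e] in [V <= e * F + e ^ (- q / (p - q))]. *)
Lemma weighted_young_opt (V : \bar R) (A F : R) : (0 < A)%R -> (0 <= F)%R ->
  0 <= V ->
  (forall e, (0 < e)%R -> V <= (A * (e * F + e `^ (- (q / (p - q)))))%:E) ->
  V <= (2 * A * F `^ (q / p))%:E.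
Proof.
have p_gt0 : (0 < p)%R by exact: lt_trans qp.
move=> A0 F0 V0 H.
(* [d] is F itself when F > 0 and is arbitrarily small when F = 0. The chosen e makes e * d and
   e^(-q/(p-q)) both equal to d^(q/p). *)
have Hd d : (0 < d)%R -> (F <= d)%R -> V <= (2 * A * d `^ (q / p))%:E.
  move=> d0 Fd; apply: (le_trans (H (d `^ (- ((p - q) / p)))%R (powR_gt0 _ d0))).
  rewrite lee_fin [(2 * A)%R]mulrC -mulrA ler_pM2l//.
  rewrite -powRrM.
  have -> : (- ((p - q) / p) * - (q / (p - q)) = q / p)%R.
    by field; rewrite !gt_eqF.
  rewrite mulr_natl mulr2n lerD2r.
  apply: (le_trans (ler_wpM2l (powR_ge0 _ _) Fd)).
  rewrite -{2}(powRr1 (ltW d0)) -powRD; last by rewrite (gt_eqF d0) implybT.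
  have -> : (- ((p - q) / p) + 1 = q / p)%R by field; rewrite gt_eqF.
  exact: lexx.
move: F0; rewrite le_eqVlt => /predU1P[F0|F0]; last exact: Hd.
rewrite -F0 powR0 ?gt_eqF ?divr_gt0// mulr0.
apply/lee_addgt0Pr => eta eta0; rewrite add0e.
have d0 : (0 < (eta / (2 * A)) `^ (p / q))%R by rewrite powR_gt0 ?divr_gt0 ?mulr_gt0.
have := Hd _ d0; rewrite -F0 (ltW d0) => /(_ isT).
rewrite -powRrM (_ : p / q * (q / p) = 1)%R; last by field; rewrite !gt_eqF.
rewrite powRr1 ?divr_ge0 ?mulr_ge0 ?(ltW eta0) ?(ltW A0)//.
by rewrite mulrC divfK// gt_eqF// mulr_gt0.
Qed.

End weighted_young.

(** * The trace inequality from the integrability of K_mu *)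

Section sufficiency.
Context {R : realType}.
Variables (alpha p q : R) (Phi : R -> R) (omega : R * R -> R).
Variable mu : {measure set (R * R) -> \bar R}.
Hypotheses (q_gt1 : (1 < q)%R) (qp : (q < p)%R).
Hypothesis weight_omega : weight omega.
Hypothesis class_B_Phi : class_B p Phi.
Hypothesis wvolume_fin : forall I, bounded_itv I -> exists2 w : R, (0 < w)%R &
  wvolume omega alpha (carleson I) = w%:E.
Variable Cd : R.
Hypothesis Cd_gt0 : (0 < Cd)%R.
Hypothesis doubling : forall I, bounded_itv I ->
  wvolume omega alpha (carleson (star I)) <= Cd%:E * wvolume omega alpha (carleson I).

Local Notation lam2 := (@lebesgue_measure R \x @lebesgue_measure R)%E.
Local Notation K := (K_fun mu omega alpha).
Local Notation W := (weight_density alpha omega).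

Let mD := @measurable_upper_half R.

Let ratio_ge0 I : bounded_itv I ->
  0 <= mu (carleson I) / wvolume omega alpha (carleson I).
Proof.
move=> /wvolume_fin[w w0 ->]; rewrite mule_ge0// inver gt_eqF//.
by rewrite lee_fin invr_ge0 ltW.
Qed.

Lemma K_fun_ge0 z : upper_half z -> 0 <= K z.
Proof. exact: sup_carleson_ge0. Qed.

Lemma measurable_K_fun : measurable_fun upper_half K.
Proof. exact: measurable_sup_carleson. Qed.

Let mKW : measurable_fun upper_half (fun z => K z * W z).
Proof.
by apply: emeasurable_funM; [exact: measurable_K_fun|exact: measurable_weight_density].
Qed.

Let KW0 z : upper_half z -> 0 <= K z * W z.
Proof. by move=> Dz; rewrite mule_ge0 ?K_fun_ge0 ?weight_density_ge0. Qed.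

Lemma carleson_star_le I : bounded_itv I ->
  mu (carleson (star I)) <= Cd%:E * \int[lam2]_(z in carleson I) (K z * W z).
Proof.
move=> bI; have bJ := bounded_star bI; have mI := measurable_carleson bI.
have ID := @carleson_upper_half R I.
set k := mu (carleson (star I)) / wvolume omega alpha (carleson (star I)).
have k0 : 0 <= k by exact: ratio_ge0.
have muE : mu (carleson (star I)) = k * wvolume omega alpha (carleson (star I)).
  have [w w0 wE] := wvolume_fin bJ.
  by rewrite /k wE inver gt_eqF// -muleA -EFinM mulVf ?gt_eqF// mule1.
rewrite muE; apply: (@le_trans _ _ (k * (Cd%:E * wvolume omega alpha (carleson I)))).
  by apply: lee_wpmul2l => //; exact: doubling.
rewrite muleCA; apply: lee_wpmul2l; first by rewrite lee_fin ltW.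
rewrite /wvolume /int_dV -[X in _ * X]/(\int[lam2]_(z in carleson I) W z).
have mWI : measurable_fun (carleson I) W.
  by apply: (measurable_funS mD ID); exact: measurable_weight_density.
rewrite -ge0_integralZl//; last by move=> z /ID Dz; exact: weight_density_ge0.
apply: ge0_le_integral => //.
- by move=> z /ID Dz; rewrite mule_ge0 ?weight_density_ge0.
- exact: measurable_funeM.
- exact: (measurable_funS mD ID).
- move=> z Iz; apply: lee_wpmul2r; first by apply: weight_density_ge0; [|exact: ID].
  have := @sup_carleson_ge R
    (fun I => mu (carleson I) / wvolume omega alpha (carleson I)) (star I) z.
  apply => //; apply: carleson_sub Iz => //; exact: sub_star.
Qed.

Lemma maximal_superlevel_le f t :
  mu (superlevel upper_half (maximal Phi omega alpha f) t) <=
  Cd%:E * \int[lam2]_(z in superlevel upper_half (maximal Phi omega alpha f) t)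
    (K z * W z).
Proof.
have := @sup_carleson_weak R mu (plane_measure (density lam2 mD mKW KW0))
  (luxembourg Phi omega alpha f) Cd t (ltW Cd_gt0).
rewrite -/(maximal Phi omega alpha f) /plane_measure/= densityE; last exact: subIsetl.
apply => I bI _; rewrite densityE; last exact: carleson_upper_half.
exact: carleson_star_le.
Qed.

Hypothesis K_Lp : Lp_weighted (p / (p - q)) omega alpha K.

Lemma maximal_trace_inequality : exists2 C1 : R, (0 < C1)%R &
  forall f : R * R -> R[i], cLp_weighted p omega alpha f ->
       (\int[mu]_(z in upper_half)
          (maximal Phi omega alpha f z `^ q)) `^ (q^-1)%R
       <= C1%:E *
          (int_dV alpha upper_half
             (fun z => (cmod f z `^ p * omega z)%:E)) `^ (p^-1)%R.
Proof.
have q_gt0 : (0 < q)%R by exact: lt_trans q_gt1.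
have p_gt1 : (1 < p)%R by exact: lt_trans qp.
have p_gt0 : (0 < p)%R by exact: lt_trans p_gt1.
have yPhi : young Phi by case: class_B_Phi.
have [C1 C10 HC1] := level_integral_compare mu lam2 mD mD q_gt0 q_gt0 Cd_gt0.
have [C2 C20 HC2] :=
  maximal_strong weight_omega yPhi wvolume_fin Cd_gt0 doubling p_gt1 class_B_Phi.
pose Y := \int[lam2]_(z in upper_half) (K z `^ (p / (p - q)) * W z).
have Y0 : 0 <= Y.
  by apply: integral_ge0 => z Dz; rewrite mule_ge0 ?poweR_ge0 ?weight_density_ge0.
have Yfin : Y < +oo.
  have [_] := K_Lp; apply: le_lt_trans; rewrite /Y /int_dV le_eqVlt; apply/orP; left.
  by apply/eqP; apply: eq_integral => z _; rewrite /weight_density muleA.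
move: Y0 Yfin; case YE : Y => [y||]// y0 _; rewrite lee_fin in y0.
(* [A] dominates both coefficients: C2 e F + y e' <= (C2 + y + 1) (e F + e'). *)
pose A : R := (C1 * (C2 + y + 1))%R.
have A0 : (0 < A)%R.
  by rewrite mulr_gt0// ltr_wpDl// addr_ge0// ltW.
exists ((2 * A) `^ q^-1)%R; first by rewrite powR_gt0// mulr_gt0.
move=> f [_ _ [mf fLp]].
have {}mf : measurable_fun upper_half (cmod f) by exact/measurable_EFinP.
rewrite int_dV_weight; set F := \int[lam2]_(z in _) _.
have F0 : 0 <= F.
  by apply: integral_ge0 => z Dz; rewrite mule_ge0 ?weight_density_ge0// lee_fin powR_ge0.
have Ffin : F < +oo.
  move: fLp; apply: le_lt_trans; rewrite /F /int_dV le_eqVlt; apply/orP; left.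
  by apply/eqP; apply: eq_integral => z _; rewrite /weight_density muleA.
move: F0 Ffin (HC2 f mf); rewrite -/F.
case: F => [F||]// F0 _ HF; rewrite lee_fin in F0.
set M := maximal Phi omega alpha f in HF *.
have mM : measurable_fun upper_half M by exact: measurable_sup_carleson.
have M0 z : upper_half z -> 0 <= M z.
  by move=> Dz; apply: sup_carleson_ge0 => // I _; exact: luxembourg_ge0.
have mWD := measurable_weight_density alpha weight_omega.
have W0 := @weight_density_ge0 R alpha omega weight_omega.
set V := \int[mu]_(z in _) _.
have V0 : 0 <= V by apply: integral_ge0 => z _; exact: poweR_ge0.
have VK : V <= C1%:E * \int[lam2]_(z in upper_half) (M z `^ q * (K z * W z)).
  rewrite (_ : V = \int[mu]_(z in upper_half) (M z `^ q * cst 1 z)); last first.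
    by apply: eq_integral => z _; rewrite mule1.
  have m1 : measurable_fun (@upper_half R) (cst (1 : \bar R)) by exact: measurable_cst.
  have m10 (z : R * R) : upper_half z -> 0 <= cst (1 : \bar R) z by [].
  apply: (HC1 _ _ _ _ mM M0 m1 m10 mM M0 mKW KW0).
  move=> t t0; rewrite muleCA; apply: lee_wpmul2l; first by rewrite lee_fin powR_ge0.
  rewrite integral_cst ?mul1e; last exact: measurable_superlevel.
  exact: maximal_superlevel_le.
have mKs : measurable_fun upper_half (fun z => K z `^ (p / (p - q)) * W z).
  apply: emeasurable_funM => //.
  exact: (measurableT_comp (measurable_poweR _) measurable_K_fun).
have mMp : measurable_fun upper_half (fun z => M z `^ p * W z).
  by apply: emeasurable_funM => //; exact: (measurableT_comp (measurable_poweR _) mM).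
(* The parameter e stays free: a fixed one would leave an additive constant instead of the
   homogeneous power F^(q/p). *)
have Ve e : (0 < e)%R -> V <= (A * (e * F + e `^ (- (q / (p - q)))))%:E.
  move=> e0; pose e' := (e `^ (- (q / (p - q))))%R.
  have e'0 : (0 < e')%R by exact: powR_gt0.
  apply: (le_trans VK); rewrite EFinM /A [(C1 * _)%:E]EFinM -muleA.
  apply: lee_wpmul2l; first by rewrite lee_fin ltW.
  apply: (@le_trans _ _ (e%:E * (C2 * F)%:E + e'%:E * y%:E)); last first.
    rewrite -!EFinM -EFinD lee_fin -/e'.
    have eF : (0 <= e * F)%R by rewrite mulr_ge0// ltW.
    rewrite -subr_ge0.
    have -> : ((C2 + y + 1) * (e * F + e') - (e * (C2 * F) + e' * y) =
        (y + 1) * (e * F) + (C2 + 1) * e')%R by ring.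
    by rewrite addr_ge0// mulr_ge0// ?addr_ge0// ltW.
  apply: (@le_trans _ _ (e%:E * \int[lam2]_(z in upper_half) (M z `^ p * W z) +
      e'%:E * Y)); last first.
    rewrite YE; apply: leeD => //; apply: lee_wpmul2l; first by rewrite lee_fin ltW.
    by rewrite EFinM.
  have eW0 z : upper_half z -> 0 <= M z `^ p * W z.
    by move=> Dz; rewrite mule_ge0 ?poweR_ge0 ?W0.
  have kW0 z : upper_half z -> 0 <= K z `^ (p / (p - q)) * W z.
    by move=> Dz; rewrite mule_ge0 ?poweR_ge0 ?W0.
  rewrite /Y -!ge0_integralZl ?lee_fin ?(ltW e0) ?(ltW e'0)//.
  rewrite -ge0_integralD//; last 4 first.
  - by move=> z Dz; rewrite mule_ge0 ?eW0// lee_fin ltW.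
  - exact: measurable_funeM.
  - by move=> z Dz; rewrite mule_ge0 ?kW0// lee_fin ltW.
  - exact: measurable_funeM.
  apply: ge0_le_integral => //.
  - by move=> z Dz; rewrite mule_ge0 ?poweR_ge0 ?KW0.
  - by apply: emeasurable_funM => //; exact: (measurableT_comp (measurable_poweR _) mM).
  - by apply: emeasurable_funD; exact: measurable_funeM.
  move=> z Dz; rewrite [leLHS]muleA [X in _ <= X + _]muleA [X in _ <= _ + X]muleA.
  rewrite -ge0_muleDl; last 2 first.
  - by rewrite mule_ge0 ?poweR_ge0// lee_fin ltW.
  - by rewrite mule_ge0 ?poweR_ge0// lee_fin ltW.
  apply: lee_wpmul2r; first exact: W0.
  by apply: weighted_younge => //; [exact: M0|exact: K_fun_ge0].
have := weighted_young_opt q_gt0 qp A0 F0 V0 Ve => VF.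
have q1_ge0 : (0 <= q^-1)%R by rewrite invr_ge0 ltW.
apply: (@le_trans _ _ ((2 * A * F `^ (q / p))%:E `^ q^-1)).
  apply: gt0_ler_poweR => //; rewrite in_itv/= ?V0 ?leey//.
  by rewrite lee_fin mulr_ge0 ?powR_ge0 ?leey// mulr_ge0// ltW.
rewrite !poweR_EFin -EFinM lee_fin powRM ?powR_ge0//; last by rewrite mulr_ge0// ltW.
rewrite -powRrM (_ : q / p / q = p^-1)%R; first exact: lexx.
by field; rewrite !gt_eqF.
Qed.

End sufficiency.

(** * Necessity *)

Section power_inequalities.
Context {R : realType}.
Implicit Types (x y : \bar R) (r : R).

Lemma le_poweR x y r : (0 <= r)%R -> 0 <= x -> x <= y -> x `^ r <= y `^ r.
Proof.
move=> r0 x0 xy; apply: gt0_ler_poweR => //; rewrite in_itv/= leey andbT//.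
exact: le_trans xy.
Qed.

Lemma poweRK x r : (0 < r)%R -> 0 <= x -> (x `^ r) `^ r^-1 = x.
Proof. by move=> r0 x0; rewrite -poweRrM mulfV ?gt_eqF// poweRe1. Qed.

Lemma poweRVK x r : (0 < r)%R -> 0 <= x -> (x `^ r^-1) `^ r = x.
Proof. by move=> r0 x0; rewrite -poweRrM mulVf ?gt_eqF// poweRe1. Qed.

(** Divide by a^(q/p). That [a] is real matters: +oo would satisfy the hypothesis, which is why K is
    truncated first. *)
Lemma absorb_power (a c p q : R) : (0 < q)%R -> (q < p)%R ->
  (0 <= a)%R -> (0 <= c)%R -> (a <= c * a `^ (q / p))%R ->
  (a <= c `^ (p / (p - q)))%R.
Proof.
move=> q0 qp a0 c0 H; have p0 : (0 < p)%R by exact: lt_trans qp.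
have pq : (0 < p - q)%R by rewrite subr_gt0.
move: a0; rewrite le_eqVlt => /predU1P[<-|a0]; first exact: powR_ge0.
have : (a `^ ((p - q) / p) <= c)%R.
  rewrite -(@ler_pM2r _ (a `^ (q / p))) ?powR_gt0// -powRD; last first.
    by rewrite (gt_eqF a0) implybT.
  rewrite (_ : (p - q) / p + q / p = 1)%R; last by field; rewrite gt_eqF.
  by rewrite powRr1// ltW.
move=> h; have : ((a `^ ((p - q) / p)) `^ (p / (p - q)) <= c `^ (p / (p - q)))%R.
  apply: ge0_ler_powR => //; first by rewrite divr_ge0// ltW.
  by rewrite nnegrE powR_ge0.
rewrite -powRrM (_ : (p - q) / p * (p / (p - q)) = 1)%R; last first.
  by field; rewrite !gt_eqF.
by rewrite powRr1// ltW.
Qed.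

End power_inequalities.

Section necessity.
Context {R : realType}.
Variables (alpha p q : R) (Phi : R -> R) (omega : R * R -> R).
Variable mu : {measure set (R * R) -> \bar R}.
Hypotheses (q_gt1 : (1 < q)%R) (qp : (q < p)%R).
Hypothesis weight_omega : weight omega.
Hypothesis young_Phi : young Phi.
Hypothesis wvolume_fin : forall I, bounded_itv I -> exists2 w : R, (0 < w)%R &
  wvolume omega alpha (carleson I) = w%:E.
Variable Cd : R.
Hypothesis Cd_gt0 : (0 < Cd)%R.
Hypothesis doubling : forall I, bounded_itv I ->
  wvolume omega alpha (carleson (star I)) <= Cd%:E * wvolume omega alpha (carleson I).

Local Notation lam2 := (@lebesgue_measure R \x @lebesgue_measure R)%E.
Local Notation K := (K_fun mu omega alpha).
Local Notation W := (weight_density alpha omega).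

Let mD := @measurable_upper_half R.
Let mW := measurable_weight_density alpha weight_omega.
Let W0 := @weight_density_ge0 R alpha omega weight_omega.

Let q_gt0 : (0 < q)%R. Proof. exact: lt_trans q_gt1. Qed.
Let p_gt0 : (0 < p)%R. Proof. exact: lt_trans qp. Qed.
Let pq_gt0 : (0 < p - q)%R. Proof. by rewrite subr_gt0. Qed.
Let s : R := (p / (p - q))%R.
Let s_gt0 : (0 < s)%R. Proof. by rewrite divr_gt0. Qed.
(** The exponent s - 1. *)
Let b : R := (q / (p - q))%R.
Let b_gt0 : (0 < b)%R. Proof. by rewrite divr_gt0. Qed.

Let ratio I := mu (carleson I) / wvolume omega alpha (carleson I).

Let ratio_ge0 I : bounded_itv I -> 0 <= ratio I.
Proof.
move=> /wvolume_fin[w w0 wE]; rewrite /ratio wE mule_ge0// inver gt_eqF//.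
by rewrite lee_fin invr_ge0 ltW.
Qed.

(** Two truncations: the cap N makes the supremum bounded, and the restriction to subintervals of
    [big_itv N] makes it vanish outside one Carleson square. Both are needed for the finiteness of
    [A N]. *)
Definition truncated_ratio (N : nat) (I : set R) : \bar R :=
  if `[< I `<=` big_itv N >] then mine (ratio I) N%:R%:E else 0.

Definition truncated_K (N : nat) : R * R -> \bar R :=
  sup_carleson (truncated_ratio N).

Let tr_ge0 N I : bounded_itv I -> 0 <= truncated_ratio N I.
Proof.
move=> bI; rewrite /truncated_ratio; case: ifPn => // _.
by rewrite le_min ratio_ge0//= lee_fin.
Qed.

Let tr_le N I : truncated_ratio N I <= N%:R%:E.
Proof.
rewrite /truncated_ratio; case: ifPn => _; last by rewrite lee_fin.
by rewrite ge_min lexx orbT.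
Qed.

Lemma measurable_truncated_K N : measurable_fun upper_half (truncated_K N).
Proof. exact: measurable_sup_carleson. Qed.

Lemma truncated_K_ge0 N z : upper_half z -> 0 <= truncated_K N z.
Proof. by apply: sup_carleson_ge0 => I; exact: tr_ge0. Qed.

Lemma truncated_K_le N z : truncated_K N z <= N%:R%:E.
Proof. by apply: ge_ereal_sup => _ [I _ <-]; exact: tr_le. Qed.

Lemma truncated_K_supp N z : upper_half z -> ~ carleson (big_itv N) z ->
  truncated_K N z = 0.
Proof.
move=> Dz Nz; apply/eqP; rewrite eq_le truncated_K_ge0// andbT.
apply: ge_ereal_sup => _ [I [bI Iz] <-]; rewrite /truncated_ratio.
case: ifPn => // /asboolP IN; exfalso; apply: Nz.
by apply: carleson_sub Iz => //; exact: bounded_big_itv.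
Qed.

Lemma truncated_K_nondecreasing z : nondecreasing_seq (truncated_K ^~ z).
Proof.
move=> m n mn; apply: ge_ereal_sup => _ [I [bI Iz] <-].
apply: le_trans (sup_carleson_ge _ bI Iz); rewrite /truncated_ratio.
case: ifPn => [/asboolP Im|_]; last exact: tr_ge0.
rewrite ifT; last first.
  by apply/asboolP; apply: subset_trans Im _; exact: sub_big_itv.
rewrite le_min !ge_min lexx/= lee_fin ler_nat mn orbT.
by [].
Qed.

(** Each I lies in some [big_itv n]. Its ratio, if finite, is eventually below the cap; if it is
    infinite, the caps themselves are unbounded. *)
Lemma K_fun_le z (y : \bar R) : (forall N, truncated_K N z <= y) -> K z <= y.
Proof.
move=> H; apply: ge_ereal_sup => _ [I [bI Iz] <-]; rewrite -/(ratio I).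
have [n0 In0] := bounded_itv_big bI.
have Hn n : (n0 <= n)%N -> mine (ratio I) n%:R%:E <= y.
  move=> n0n; apply: le_trans (H n).
  apply: le_trans (sup_carleson_ge _ bI Iz); rewrite /truncated_ratio ifT//.
  by apply/asboolP; apply: subset_trans In0 _; exact: sub_big_itv.
have := ratio_ge0 bI; case: (ratio I) Hn => [r||]// Hn r0.
  pose n := (n0 + (Num.truncn r).+1)%N.
  have := Hn n (leq_addr _ _); rewrite min_l//.
  rewrite lee_fin (le_trans (ltW (truncnS_gt r)))// ler_nat /n.
  exact: leq_addl.
rewrite leye_eq; apply/eqP/eqyP => a a0.
apply: le_trans (Hn (n0 + (Num.truncn a).+1)%N (leq_addr _ _)).
rewrite min_r ?leey// lee_fin (le_trans (ltW (truncnS_gt a)))// ler_nat.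
exact: leq_addl.
Qed.

(** The exponent gives test^p = K^s and test^q = K^(s-1) for the truncated K. On the half-plane
    [fine] loses nothing, as the truncation lies between 0 and N. *)
Let test N (z : R * R) : R := (fine (truncated_K N z) `^ (p - q)^-1)%R.

Let test_ge0 N z : (0 <= test N z)%R. Proof. exact: powR_ge0. Qed.

Let testf N (z : R * R) : R[i] := Complex (test N z) 0%R.

Let cmod_testf N z : cmod (testf N) z = test N z.
Proof. by rewrite /cmod /testf/= expr0n/= addr0 sqrtr_sqr ger0_norm. Qed.

Let truncated_KE N z : upper_half z ->
  truncated_K N z = (fine (truncated_K N z))%:E.
Proof.
move=> Dz; rewrite fineK// ge0_fin_numE ?truncated_K_ge0//.
by rewrite (le_lt_trans (truncated_K_le N z))// ltry.
Qed.

Let testE N z : upper_half z -> (test N z)%:E = truncated_K N z `^ (p - q)^-1.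
Proof. by move=> Dz; rewrite [in RHS]truncated_KE. Qed.

Let measurable_test N : measurable_fun upper_half (test N).
Proof.
apply: (measurableT_comp (measurable_powR _)).
apply: measurableT_comp; last exact: measurable_truncated_K.
exact: fine_measurable.
Qed.

Let A N := \int[lam2]_(z in upper_half) (truncated_K N z `^ s * W z).

Let A_ge0 N : 0 <= A N.
Proof. by apply: integral_ge0 => z Dz; rewrite mule_ge0 ?poweR_ge0 ?W0. Qed.

Let mA N : measurable_fun upper_half (fun z => truncated_K N z `^ s * W z).
Proof.
apply: emeasurable_funM => //.
exact: (measurableT_comp (measurable_poweR _) (measurable_truncated_K N)).
Qed.

Let A_fin N : A N < +oo.
Proof.
have bN := @bounded_big_itv R N; have [w w0 wE] := wvolume_fin bN.
have mQ := measurable_carleson bN.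
have mWQ : measurable_fun upper_half (W \_ (carleson (big_itv N))).
  apply/(measurable_restrict W mQ mD); apply: (measurable_funS mD _ mW).
  exact: subIsetl.
have WQ0 z : upper_half z -> 0 <= (W \_ (carleson (big_itv N))) z.
  by move=> Dz; rewrite patchE; case: ifPn => // _; exact: W0.
apply: (@le_lt_trans _ _ ((N%:R `^ s)%:E * w%:E)); last by rewrite -EFinM ltry.
have -> : w%:E = \int[lam2]_(z in upper_half) (W \_ (carleson (big_itv N))) z.
  rewrite -wE -integral_mkcondr setIidr//; exact: carleson_upper_half.
rewrite -ge0_integralZl//.
apply: ge0_le_integral => //.
- by move=> z Dz; rewrite mule_ge0 ?poweR_ge0 ?W0.
- exact: mA.
- exact: measurable_funeM.
- move=> z Dz; rewrite patchE; case: ifPn => [_|/negP]; last first.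
    rewrite in_setE => Nz; rewrite truncated_K_supp// poweR0r ?gt_eqF// mul0e.
    by rewrite mule_ge0// lee_fin powR_ge0.
  apply: lee_wpmul2r; first exact: W0.
  rewrite -poweR_EFin; apply: le_poweR; [exact: ltW|exact: truncated_K_ge0|].
  exact: truncated_K_le.
Qed.

Let testf_Lp N : cLp_weighted p omega alpha (testf N).
Proof.
have mt : measurable_fun upper_half (cmod (testf N)).
  by apply: (eq_measurable_fun (test N)) => // z _; rewrite cmod_testf.
split.
- exact: measurable_test.
- exact: measurable_cst.
split; first exact/measurable_EFinP.
apply: le_lt_trans (A_fin N); rewrite /int_dV /A le_eqVlt; apply/orP; left.
apply/eqP; apply: eq_integral => z; rewrite inE => Dz.
rewrite /weight_density muleA/= cmod_testf -poweR_EFin testE// -poweRrM.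
by rewrite mulrC.
Qed.

Let testf_integral N : int_dV alpha upper_half
  (fun z => (cmod (testf N) z `^ p * omega z)%:E) = A N.
Proof.
rewrite int_dV_weight; apply: eq_integral => z; rewrite inE => Dz.
by rewrite cmod_testf -poweR_EFin testE// -poweRrM mulrC.
Qed.

(** If c is the truncated ratio of I, then on all of Q_I the truncated K is at least c and [test] at
    least c^(1/(p-q)); by [luxembourg_ge] so is the norm over Q_I. *)
Let maximal_test N z : upper_half z ->
  truncated_K N z `^ (p - q)^-1 <= maximal Phi omega alpha (testf N) z.
Proof.
move=> Dz; set M := maximal _ _ _ _ z.
have M0 : 0 <= M.
  by apply: sup_carleson_ge0 => // I _; exact: luxembourg_ge0.
have r0 : (0 < (p - q)^-1)%R by rewrite invr_gt0.
have mt : measurable_fun upper_half (cmod (testf N)).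
  apply: (eq_measurable_fun (test N)); last exact: measurable_test.
  by move=> w _; rewrite cmod_testf.
(* The power moves to the maximal function, so that the supremum defining K can be bounded term by
   term. *)
rewrite -(poweRK pq_gt0 M0); apply: le_poweR; [exact: ltW|exact: truncated_K_ge0|].
apply: ge_ereal_sup => _ [I [bI Iz] <-].
have ID := @carleson_upper_half R I.
have cN := tr_le N I.
have [->|c_neq0] := eqVneq (truncated_ratio N I) 0; first exact: poweR_ge0.
have c0 : 0 < truncated_ratio N I by rewrite lt0e c_neq0 tr_ge0.
rewrite -[leLHS](poweRVK pq_gt0 (ltW c0)).
apply: le_poweR; [exact: ltW|exact: poweR_ge0|].
have cE : truncated_ratio N I = (fine (truncated_ratio N I))%:E.
  by rewrite fineK// ge0_fin_numE ?(ltW c0)// (le_lt_trans cN)// ltry.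
rewrite cE poweR_EFin.
have := @sup_carleson_ge R (luxembourg Phi omega alpha (testf N)) I z bI Iz.
apply: le_trans.
apply: luxembourg_ge => //.
  by rewrite powR_gt0// -lte_fin -cE.
move=> w Iw; rewrite cmod_testf -lee_fin testE; last exact: ID.
rewrite -poweR_EFin -cE; apply: le_poweR; [exact: ltW|exact: ltW|].
exact: sup_carleson_ge.
Qed.

Let B N := \int[mu]_(z in upper_half) (truncated_K N z `^ b).

Let B_le N : B N <= \int[mu]_(z in upper_half)
  (maximal Phi omega alpha (testf N) z `^ q).
Proof.
apply: ge0_le_integral => //.
- by move=> z _; exact: poweR_ge0.
- exact: (measurableT_comp (measurable_poweR _) (measurable_truncated_K N)).
- apply: (measurableT_comp (measurable_poweR _)).
  exact: measurable_sup_carleson.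
- move=> z Dz; rewrite /b [(q / _)%R]mulrC poweRrM.
  by apply: le_poweR; [exact: ltW|exact: poweR_ge0|exact: maximal_test].
Qed.

(** Truncation only lowers the ratio, so t < c I gives t w(Q_I) <= mu(Q_I); doubling then reaches
    [star I] at the cost [Cd]. *)
Let truncated_K_weak N t : (0 < t)%R ->
  t%:E * \int[lam2]_(z in superlevel upper_half (truncated_K N) t) W z <=
  Cd%:E * mu (superlevel upper_half (truncated_K N) t).
Proof.
move=> t0.
have := @sup_carleson_weak R (plane_measure (density lam2 mD mW W0)) mu
  (truncated_ratio N) (Cd / t) t.
rewrite -/(truncated_K N) /plane_measure/= densityE; last exact: subIsetl.
rewrite divr_ge0 ?(ltW t0) ?(ltW Cd_gt0)// => /(_ isT) weak.
rewrite -lee_pdivlMl// muleA -EFinM mulrC; apply: weak => I bI tI.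
rewrite densityE; last exact: carleson_upper_half.
apply: (le_trans (doubling bI)); rewrite EFinM -muleA.
apply: lee_wpmul2l; first by rewrite lee_fin ltW.
rewrite lee_pdivlMl//.
have tr : t%:E < ratio I.
  move: tI; rewrite /truncated_ratio; case: ifPn => _.
    by rewrite lt_min => /andP[].
  by rewrite lte_fin ltNge (ltW t0).
have [w w0 wE] := wvolume_fin bI; move: tr; rewrite /ratio wE inver gt_eqF//.
by rewrite lte_pdivlMr// => /ltW.
Qed.

Variable C1 : R.
Hypothesis C1_gt0 : (0 < C1)%R.
Hypothesis maximal_bound :
  forall f : R * R -> R[i], cLp_weighted p omega alpha f ->
       (\int[mu]_(z in upper_half)
          (maximal Phi omega alpha f z `^ q)) `^ (q^-1)%R
       <= C1%:E *
          (int_dV alpha upper_half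
             (fun z => (cmod f z `^ p * omega z)%:E)) `^ (p^-1)%R.

Let A_bound : exists A1 : R, forall N, A N <= A1%:E.
Proof.
have [C3 C30 HC3] := level_integral_compare lam2 mu mD mD s_gt0 b_gt0 Cd_gt0.
(* What remains, independently of N, after absorption in A <= C3 * C1^q * A^(q/p). *)
exists ((C3 * C1 `^ q) `^ s)%R => N.
have AB : A N <= C3%:E * B N.
  rewrite (_ : B N = \int[mu]_(z in upper_half) (truncated_K N z `^ b * cst 1 z)); last first.
    by apply: eq_integral => z _; rewrite mule1.
  have m1 : measurable_fun (@upper_half R) (cst (1 : \bar R)) by exact: measurable_cst.
  have m10 (z : R * R) : upper_half z -> 0 <= cst (1 : \bar R) z by [].
  have mt := measurable_truncated_K N; have t_ge0 := @truncated_K_ge0 N.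
  apply: (HC3 _ _ _ _ mt t_ge0 mW W0 mt t_ge0 m1 m10).
  (* As s = b + 1, the spare factor t is the one in the weak bound t w(E) <= Cd mu(E). *)
  move=> t t0; rewrite integral_cst ?mul1e; last exact: measurable_superlevel.
  have -> : (t `^ s = t `^ b * t)%R.
    rewrite (_ : s = b + 1)%R; last by rewrite /s /b; field; rewrite gt_eqF.
    by rewrite powRD ?powRr1 ?(ltW t0)// (gt_eqF t0) implybT.
  rewrite EFinM -muleA [leRHS]muleCA; apply: lee_wpmul2l; first by rewrite lee_fin powR_ge0.
  exact: truncated_K_weak.
have BA : B N <= (C1 `^ q)%:E * A N `^ (q / p).
  have := maximal_bound (testf_Lp N); rewrite testf_integral => H.
  apply: (le_trans (B_le N)).
  set V := \int[mu]_(z in _) _ in H *.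
  have V0 : 0 <= V by apply: integral_ge0 => z _; exact: poweR_ge0.
  rewrite -(poweRVK q_gt0 V0).
  apply: (le_trans (le_poweR (ltW q_gt0) (poweR_ge0 _ _) H)).
  rewrite poweRM ?poweR_ge0//; last by rewrite lee_fin ltW.
  by rewrite poweR_EFin -poweRrM mulrC.
have := A_ge0 N; have := A_fin N; move: AB BA.
case: (A N) => [a||]// AB BA _; rewrite lee_fin => a0.
rewrite lee_fin; apply: absorb_power => //.
  by rewrite mulr_ge0 ?powR_ge0// ltW.
rewrite -lee_fin; apply: (le_trans AB).
rewrite -mulrA [leRHS]EFinM; apply: lee_wpmul2l; first by rewrite lee_fin ltW.
by rewrite EFinM -poweR_EFin.
Qed.

Lemma K_fun_Lp : Lp_weighted s omega alpha K.
Proof.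
have [A1 HA] := A_bound; split; first exact: measurable_sup_carleson.
have K0 z : upper_half z -> 0 <= K z.
  by move=> Dz; apply: sup_carleson_ge0.
have -> : int_dV alpha upper_half (fun z => K z `^ s * (omega z)%:E) =
    \int[lam2]_(z in upper_half) (K z `^ s * W z).
  by apply: eq_integral => z _; rewrite /weight_density muleA.
have A0 N z : upper_half z -> 0 <= truncated_K N z `^ s * W z.
  by move=> Dz; rewrite mule_ge0 ?poweR_ge0 ?W0.
have ndA z : upper_half z ->
    nondecreasing_seq (fun N => truncated_K N z `^ s * W z).
  move=> Dz m n mn; apply: lee_wpmul2r; first exact: W0.
  apply: le_poweR; [exact: ltW|exact: truncated_K_ge0|].
  exact: truncated_K_nondecreasing.
apply: (@le_lt_trans _ _ A1%:E); last exact: ltry.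
apply: (@le_trans _ _ (\int[lam2]_(z in upper_half)
    limn (fun N => truncated_K N z `^ s * W z))); last first.
  rewrite (monotone_convergence lam2 mD mA A0 ndA); apply: lime_le.
    apply: ereal_nondecreasing_is_cvgn => m n mn.
    apply: ge0_le_integral => //; [by move=> z; exact: A0|exact: mA|exact: mA|].
    by move=> z Dz; exact: ndA.
  by apply: nearW => N; exact: HA.
have cvgA z : upper_half z -> cvgn (fun N => truncated_K N z `^ s * W z).
  by move=> Dz; apply: ereal_nondecreasing_is_cvgn; exact: ndA.
have leA z N : upper_half z -> truncated_K N z `^ s * W z <=
    limn (fun N => truncated_K N z `^ s * W z).
  move=> Dz; rewrite (cvg_lim _ (ereal_nondecreasing_cvgn (ndA z Dz)))//.
  by apply: ereal_sup_ubound; exists N.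
apply: ge0_le_integral => //.
- by move=> z Dz; rewrite mule_ge0 ?poweR_ge0 ?W0.
- apply: emeasurable_funM => //; apply: (measurableT_comp (measurable_poweR _)).
  exact: measurable_sup_carleson.
- by apply: (emeasurable_fun_cvg (fun N z => truncated_K N z `^ s * W z)) => // z Dz; exact: cvgA.
(* To bound K^s W by the limit L, divide by w = W z and take s-th roots, which reduces the claim to
   [K_fun_le]. Where w = 0 the left side vanishes. *)
move=> z Dz; have LK N := leA z N Dz; set L := limn _ in LK *.
have [w w0 WE] : exists2 w : R, (0 <= w)%R & W z = w%:E.
  exists (omega z * z.2 `^ alpha)%R; last by rewrite /weight_density EFinM.
  by rewrite -lee_fin EFinM; exact: W0.
rewrite WE; have {}LK N : truncated_K N z `^ s * w%:E <= L by rewrite -WE.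
move: w0; rewrite le_eqVlt => /predU1P[w0|w0].
  by have := LK 0%N; rewrite -w0 !mule0.
have L0 : 0 <= L.
  by apply: le_trans (LK 0%N); rewrite mule_ge0 ?poweR_ge0// lee_fin ltW.
have Lw0 : 0 <= L * (w^-1)%:E by rewrite mule_ge0// lee_fin invr_ge0 ltW.
rewrite -lee_pdivlMr// -[leRHS](poweRVK s_gt0 Lw0).
apply: le_poweR; [exact: ltW|exact: K0|].
apply: K_fun_le => N.
rewrite -[leLHS](poweRK s_gt0 (truncated_K_ge0 N Dz)).
apply: le_poweR; [by rewrite invr_ge0 ltW|exact: poweR_ge0|].
by rewrite lee_pdivlMr.
Qed.

End necessity.

(** * Vanishing weights and the main theorem *)

Section vanishing_weight.
Context {R : realType}.
Variables (alpha : R) (omega : R * R -> R).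
Hypothesis weight_omega : weight omega.
Hypothesis wvolume0 : wvolume omega alpha upper_half = 0.

Local Notation lam2 := (@lebesgue_measure R \x @lebesgue_measure R)%E.
Local Notation W := (weight_density alpha omega).

Let mD := @measurable_upper_half R.

Lemma integral_weight0 (h : R * R -> \bar R) : measurable_fun upper_half h ->
  (forall z, upper_half z -> 0 <= h z) ->
  \int[lam2]_(z in upper_half) (h z * W z) = 0.
Proof.
move=> mh h0; have mW := measurable_weight_density alpha weight_omega.
have W0 := @weight_density_ge0 R alpha omega weight_omega.
have aeW : ae_eq lam2 upper_half W (cst 0).
  apply/(ae_eq_integral_abs lam2 mD mW); rewrite -[RHS]wvolume0.
  by apply: eq_integral => z; rewrite inE => Dz; rewrite gee0_abs// W0.
rewrite -(@integral0 _ _ _ lam2 upper_half); apply: ge0_ae_eq_integral => //.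
- exact: emeasurable_funM.
- by move=> z Dz; rewrite mule_ge0 ?h0 ?W0.
- by apply: filterS aeW => z Wz Dz; rewrite Wz// mule0.
Qed.

Lemma Lp_weighted0 (s : R) (h : R * R -> \bar R) : measurable_fun upper_half h ->
  Lp_weighted s omega alpha h.
Proof.
move=> mh; split => //.
rewrite (_ : int_dV _ _ _ = \int[lam2]_(z in upper_half) (h z `^ s * W z)).
  rewrite integral_weight0 ?ltry//; last by move=> z _; exact: poweR_ge0.
  exact: (measurableT_comp (measurable_poweR _) mh).
by apply: eq_integral => z _; rewrite /weight_density muleA.
Qed.

(** Both the integral and the weighted volume of a square are 0, so the average reads 0 * +oo = 0
    and every l > 0 is admissible in the infimum. *)
Lemma maximal_eq0 (Phi : R -> R) (f : R * R -> R[i]) z : young Phi ->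
  measurable_fun upper_half (cmod f) -> upper_half z ->
  maximal Phi omega alpha f z = 0.
Proof.
move=> yPhi mf Dz; apply/eqP; rewrite eq_le; apply/andP; split; last first.
  by apply: sup_carleson_ge0 => // I _; exact: luxembourg_ge0.
apply: ge_ereal_sup => _ [I [bI Iz] <-].
apply/lee_addgt0Pr => l l0; rewrite add0e.
apply: ereal_inf_lbound; exists l => //; split => //.
rewrite int_dV_weight (_ : \int[_]_(_ in _) _ = 0) ?mul0e//.
have h0 w : (0 <= Phi (cmod f w / l))%R.
  by apply: (young_ge0 yPhi); rewrite divr_ge0 ?cmod_ge0// ltW.
have mh : measurable_fun upper_half (fun w => (Phi (cmod f w / l))%:E).
  apply/measurable_EFinP; apply: (measurable_young yPhi).
    by apply: measurable_funM => //; exact: measurable_cst.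
  by move=> w; rewrite divr_ge0 ?cmod_ge0// ltW.
have W0 := @weight_density_ge0 R alpha omega weight_omega.
have hW0 w : upper_half w -> 0 <= (Phi (cmod f w / l))%:E * W w.
  by move=> Dw; rewrite mule_ge0 ?W0// lee_fin.
apply/eqP; rewrite eq_le; apply/andP; split; last first.
  by apply: integral_ge0 => w /carleson_upper_half; exact: hW0.
rewrite -(integral_weight0 mh (fun w _ => h0 w)).
apply: ge0_subset_integral => //.
- exact: measurable_carleson.
- by apply: emeasurable_funM => //; exact: measurable_weight_density.
- exact: carleson_upper_half.
Qed.

End vanishing_weight.

Theorem theorem1p2 (R : realType) (alpha p q : R) (Phi : R -> R)
    (omega : R * R -> R) (mu : {measure set (R * R) -> \bar R}) :
  (-1 < alpha)%R -> (1 < q)%R -> (q < p)%R ->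
  weight omega -> class_B p Phi -> BB_infty omega alpha ->
  (exists2 C1 : R, (0 < C1)%R &
     forall f : R * R -> R[i], cLp_weighted p omega alpha f ->
       (\int[mu]_(z in upper_half)
          (maximal Phi omega alpha f z `^ q)) `^ (q^-1)%R
       <= C1%:E *
          (int_dV alpha upper_half
             (fun z => (cmod f z `^ p * omega z)%:E)) `^ (p^-1)%R)
  <-> Lp_weighted (p / (p - q))%R omega alpha (K_fun mu omega alpha).
Proof.
move=> alphaN1 q_gt1 qp weight_omega class_B_Phi [r r_gt1 BB_omega].
have yPhi : young Phi by case: class_B_Phi.
have [w0|wvolume_fin] := wvolume_dichotomy alphaN1 r_gt1 weight_omega BB_omega.
  (* For a null weight both sides of the equivalence hold: K_mu is measurable, hence in L^s, and the
     maximal function vanishes on the half-plane. *)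
  split=> _; first by apply: Lp_weighted0 => //; exact: measurable_sup_carleson.
  exists 1%R => // f [_ _ [mf _]].
  have {}mf : measurable_fun upper_half (cmod f) by exact/measurable_EFinP.
  have q0 : (0 < q)%R by exact: lt_trans q_gt1.
  rewrite (_ : \int[mu]_(z in upper_half) _ = 0).
    by rewrite poweR0r ?invr_eq0 ?gt_eqF// mul1e poweR_ge0.
  apply: integral0_eq => z Dz.
  by rewrite (maximal_eq0 weight_omega w0 yPhi mf Dz) poweR0r ?gt_eqF.
have [Cd Cd_gt0 doubling] := wvolume_doubling alphaN1 r_gt1 weight_omega BB_omega.
split=> [[C1 C1_gt0 HC1]|K_Lp].
  exact: (K_fun_Lp q_gt1 qp weight_omega yPhi wvolume_fin Cd_gt0 doubling C1_gt0 HC1).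
exact: (maximal_trace_inequality q_gt1 qp weight_omega class_B_Phi wvolume_fin
  Cd_gt0 doubling K_Lp).
Qed.
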